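(* Let $A\in\Omega_n$ and $B\in C_A$. Then the following conditions are equivalent: (a) there is a holomorphic map $\varphi:\mathbb C\to\Omega_n$ with $\varphi(0)=A$ and $\varphi'(0)=B$; (b) there are a sequence of positive numbers $(r_j)_{j\ge 1}$ with $r_j\to\infty$ and holomorphic maps $\varphi_j:r_j\mathbb D\to\Omega_n$, $j\ge1$, uniformly bounded near $0$ (that is, uniformly bounded in $j$ on some fixed neighborhood of $0$), such that $\varphi_j(0)=A$ and $\varphi_j'(0)=B$ for all $j$; (c) there are $r>0$ and a holomorphic map $\varphi:r\mathbb D\to\Omega_n$ with values in $L_A$ such that $\varphi(0)=A$ and $\varphi'(0)=B$.
   Context: $\mathbb D$ is the open unit disc in $\mathbb C$ and $r\mathbb D=\{\zeta\in\mathbb C:|\zeta|<r\}$. $\mathcal M_n$ is the set of all $n\times n$ complex matrices (identified with $\mathbb C^{n^2}$). For $A\in\mathcal M_n$, $sp(A)$ is the spectrum (set of eigenvalues) of $A$ and $r(A)=\max_{\lambda\in sp(A)}|\lambda|$ its spectral radius. The spectral ball is $\Omega_n:=\{A\in\mathcal M_n: r(A)<1\}$. For $A\in\Omega_n$, the isospectral variety is $L_A:=\{C\in\Omega_n: sp(C)=sp(A)\}$, and $C_A$ is the tangent cone to $L_A$ at $A$: $C_A$ is the set of all $B\in\mathcal M_n$ for which there exist matrices $C_j\in L_A$ with $C_j\to A$ and real numbers $c_j>0$ ($j=1,2,\dots$) such that $c_j(C_j-A)\to B$ as $j\to\infty$. *)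

(* Defs.v *)
From mathcomp Require Import all_boot all_order all_algebra.
From mathcomp Require Import all_classical all_reals all_analysis.
From mathcomp Require Import complex.

Set Implicit Arguments.
Unset Strict Implicit.
Unset Printing Implicit Defensive.

Import Order.TTheory GRing.Theory Num.Theory.
Import numFieldNormedType.Exports.
Import ComplexField.Normc.

Local Open Scope classical_set_scope.
Local Open Scope ring_scope.
Local Open Scope complex_scope.

(* [R[i]] has no topology of its own in the libraries; packed as a
   [numClosedFieldType] it inherits the one every [numFieldType] gets from its
   norm [`|_|], as do the matrices over it (maximum norm of the entries). *)
Definition Cplx (R : realType) : numClosedFieldType := R[i].

Definition disc (R : realType) (r : R) : set (Cplx R) :=
  [set z | `|z| < r%:C].

(* For [U] open, as it always is here, [derivable f z 1] is complex
   differentiability at [z]: the scalars, hence the increments, are complex.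
   The values of [f] outside [U] are irrelevant. *)
Definition holomorphic (R : realType) (n : nat) (U : set (Cplx R))
    (f : Cplx R -> 'M[Cplx R]_n) : Prop :=
  forall z, U z -> derivable f z 1.

Definition spectrum (R : realType) (n : nat) (A : 'M[Cplx R]_n) :
    set (Cplx R) :=
  [set a | eigenvalue A a].

(* [normc] is the modulus with values in [R], where [`|_|] lands in [R[i]].
   The supremum is a maximum for [0 < n]: see [spectral_radius_max]. *)
Definition spectral_radius (R : realType) (n : nat) (A : 'M[Cplx R]_n) : R :=
  sup [set normc a | a in spectrum A].

Definition spectral_ball (R : realType) (n : nat) : set 'M[Cplx R]_n :=
  [set A | spectral_radius A < 1].
Arguments spectral_ball : clear implicits.

Definition isospectral (R : realType) (n : nat) (A : 'M[Cplx R]_n) :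
    set 'M[Cplx R]_n :=
  [set C | spectral_ball R n C /\ spectrum C = spectrum A].

Definition tangent_cone (R : realType) (n : nat) (A : 'M[Cplx R]_n) :
    set 'M[Cplx R]_n :=
  [set B | exists (C : nat -> 'M[Cplx R]_n) (c : nat -> R),
     [/\ forall j, isospectral A (C j),
         C @ \oo --> A,
         forall j, 0 < c j &
         (fun j => ((c j)%:C : Cplx R) *: (C j - A)) @ \oo --> B]].

Lemma spectral_radius_max (R : realType) (n : nat) (A : 'M[Cplx R]_n) :
  (0 < n)%N ->
  (exists2 a, spectrum A a & normc a = spectral_radius A) /\
  (forall a, spectrum A a -> normc a <= spectral_radius A).
Proof.
move=> n0.
have [s] := closed_field_poly_normal (char_poly A).
rewrite (monicP (char_poly_monic A)) scale1r => Es.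
have Sp a : spectrum A a <-> a \in s.
  by rewrite /spectrum /= eigenvalue_root_char Es root_prod_XsubC.
case: s Es Sp => [|b s] Es Sp.
  have := size_char_poly A; rewrite Es big_nil size_poly1 => -[n_eq0].
  by rewrite -n_eq0 in n0.
have [a sa amax] : exists2 a, a \in b :: s &
    forall x, x \in b :: s -> normc x <= normc a.
  elim: (s) (b) => [|c t IH] d.
    by exists d; rewrite ?mem_head // => x; rewrite inE => /eqP ->.
  have [a at_ amax] := IH c.
  have [le_da|lt_ad] := leP (normc d) (normc a).
    exists a; first by rewrite inE at_ orbT.
    by move=> x; rewrite inE => /orP[/eqP->|/amax].
  exists d; first exact: mem_head.
  move=> x; rewrite inE => /orP[/eqP->//|/amax xa].
  exact: le_trans xa (ltW lt_ad).
suff <- : normc a = spectral_radius A.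
  by split=> [|x /Sp/amax//]; exists a => //; exact/Sp.
have ubA : ubound [set normc x | x in spectrum A] (normc a).
  by move=> _ [x /Sp/amax xa <-].
apply/le_anti/andP; split.
  apply: ub_le_sup; first by exists (normc a).
  by exists a => //; exact/Sp.
by apply: ge_sup => //; exists (normc a), a => //; exact/Sp.
Qed.

(* Main.v *)
(* The characteristic polynomial of a holomorphic map into the spectral ball has
   bounded coefficients; by Cauchy's estimates, their Taylor coefficients of
   positive order tend to zero when the radius of the disc tends to infinity.
   Under (b) the N-jets at 0 of the maps phi_j stay bounded, and any cluster
   point P of them is a matrix of polynomials, with 1-jet (A, B), whose
   characteristic polynomial is constant modulo X^N. Under (c) an N-jet of phi
   has the same property, since a characteristic polynomial with prescribed
   roots takes finitely many values. No limit of maps is needed.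

   For N = 2 * n! such a jet P can be replaced, without changing its 1-jet, by a
   matrix of polynomials whose characteristic polynomial is exactly that of A:
   if a is an eigenvalue of A then det (P - a) = 0 modulo X^N, so P - a kills
   modulo X^(N / n) some v with v(0) <> 0; completing v to a unipotent
   polynomial change of basis makes P block triangular modulo X^(N / n), and one
   recurses on the lower block. This polynomial curve is entire and isospectral
   to A, which gives (a) and (c).

   The Taylor jets come from Cauchy's formula, proved by Goursat's bisection. *)
Require Import Defs.
From mathcomp Require Import all_boot all_order all_fingroup all_algebra.
From mathcomp Require Import all_classical all_reals all_analysis.
From mathcomp Require Import complex lra ring.
Import Order.TTheory GRing.Theory Num.Theory.
Import numFieldNormedType.Exports.
Import ComplexField.Normc.
Local Open Scope classical_set_scope.
Local Open Scope ring_scope.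
Local Open Scope complex_scope.
Set Implicit Arguments.
Unset Strict Implicit.
Unset Printing Implicit Defensive.

Local Notation Re := complex.Re.
Local Notation Im := complex.Im.

(** * Matrices of polynomials modulo a power of X *)

Definition mxdvd (F : fieldType) (d : {poly F}) (m n : nat)
  (M : 'M[{poly F}]_(m, n)) := [forall i, forall j, d %| M i j].

Section MxDvd.
Variables (F : fieldType) (d : {poly F}).

Lemma mxdvdP m n (M : 'M[{poly F}]_(m, n)) :
  reflect (forall i j, d %| M i j) (mxdvd d M).
Proof. exact: (iffP 'forall_forallP). Qed.

Lemma mxdvdD m n (M N : 'M[{poly F}]_(m, n)) :
  mxdvd d M -> mxdvd d N -> mxdvd d (M + N).
Proof.
by move=> /mxdvdP dM /mxdvdP dN; apply/mxdvdP => i j; rewrite mxE dvdp_add.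
Qed.

Lemma mxdvdN m n (M : 'M[{poly F}]_(m, n)) : mxdvd d M -> mxdvd d (- M).
Proof. by move=> /mxdvdP dM; apply/mxdvdP => i j; rewrite mxE dvdpNr. Qed.

Lemma dvdp_sumr I (r : seq I) (P : pred I) (E : I -> {poly F}) :
  (forall i, P i -> d %| E i) -> d %| \sum_(i <- r | P i) E i.
Proof.
move=> dE; elim/big_rec: _ => [|i p Pi dp]; first exact: dvdp0.
by rewrite dvdp_add ?dE.
Qed.

Lemma mxdvd_mulr m n p (M : 'M[{poly F}]_(m, n)) (N : 'M[{poly F}]_(n, p)) :
  mxdvd d M -> mxdvd d (M *m N).
Proof.
move=> /mxdvdP dM; apply/mxdvdP => i j; rewrite mxE.
by apply: dvdp_sumr => k _; rewrite dvdp_mulr.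
Qed.

Lemma mxdvd_mull m n p (M : 'M[{poly F}]_(m, n)) (N : 'M[{poly F}]_(n, p)) :
  mxdvd d N -> mxdvd d (M *m N).
Proof.
move=> /mxdvdP dN; apply/mxdvdP => i j; rewrite mxE.
by apply: dvdp_sumr => k _; rewrite dvdp_mull.
Qed.

End MxDvd.

Lemma mxdvd_trans (F : fieldType) (d e : {poly F}) m n (M : 'M[{poly F}]_(m, n)) :
  e %| d -> mxdvd d M -> mxdvd e M.
Proof.
by move=> ed /mxdvdP dM; apply/mxdvdP => i j; exact: dvdp_trans ed (dM i j).
Qed.


(** * Kernel vectors modulo a power of X *)

Section KernelVector.
Variable F : fieldType.
Implicit Type d k n : nat.

Lemma dvdXn_coef n (p : {poly F}) :
  reflect (forall i, (i < n)%N -> p`_i = 0) ('X^n %| p).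
Proof.
apply: (iffP idP) => [/dvdpP[q ->] i lt_in|p0].
  by rewrite coefMXn lt_in.
apply/dvdpP; exists (drop_poly n p).
rewrite -[LHS](poly_take_drop n).
suff -> : take_poly n p = 0 by rewrite add0r.
by apply/polyP => i; rewrite coef_take_poly coef0; case: ifP => // /p0.
Qed.

Lemma coprimep_Xn n (u : {poly F}) : u.[0] != 0 -> coprimep 'X^n u.
Proof.
by move=> u0; rewrite coprimep_expl // coprimep_sym coprimepX.
Qed.

Lemma mxdvd_factor d m n (M : 'M[{poly F}]_(m, n)) :
  mxdvd 'X^d M -> exists M', M = 'X^d *: M'.
Proof.
move=> /mxdvdP dM; exists (\matrix_(i, j) (M i j %/ 'X^d)).
by apply/matrixP => i j; rewrite !mxE mulrC divpK.
Qed.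

Lemma mxdvd_order k m n (M : 'M[{poly F}]_(m, n)) : ~~ mxdvd 'X^k M ->
  exists d (M' : 'M[{poly F}]_(m, n)) i j,
    [/\ (d < k)%N, M = 'X^d *: M' & (M' i j).[0] != 0].
Proof.
elim: k => [|k IH] ndvd.
  by case/mxdvdP: ndvd => i j; rewrite expr0 dvd1p.
have [/mxdvd_factor[M' M'E]|/IH] := boolP (mxdvd 'X^k M); last first.
  by move=> [d [M' [i [j [? ? ?]]]]]; exists d, M', i, j; split => //; apply: ltnW.
have : ~~ mxdvd 'X M'.
  apply: contra ndvd => /mxdvdP dM'; apply/mxdvdP => i j.
  by rewrite M'E mxE exprSr dvdp_mul.
move=> /forallPn[i /forallPn[j]].
have := dvdp_XsubCl (M' i j) 0; rewrite subr0 => -> Mij0.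
by exists k, M', i, j.
Qed.

(* Elimination without divisions: factor out the least power of X dividing all
   the entries, then use as pivot an entry u with u(0) <> 0. *)
Lemma kernel_vector k n (M : 'M[{poly F}]_n) : 'X^((n * k).+1) %| \det M ->
  exists2 v : 'cV[{poly F}]_n,
    mxdvd 'X^(k.+1) (M *m v) & exists i, (v i 0).[0] != 0.
Proof.
elim: n M => [|n IH] M.
  (* For [n = 0] the hypothesis reads ['X %| 1]; the successor in the exponent is what makes it
     absurd. *)
  by rewrite det_mx00 mul0n expr1 dvdp1 size_polyX.
move=> detM.
have [kM|/mxdvd_order[d [M0 [i0 [j0 [lt_dk ME u0]]]]]] :=
  boolP (mxdvd 'X^(k.+1) M).
  exists (const_mx 1); first exact: mxdvd_mulr.
  by exists 0; rewrite mxE hornerC oner_neq0.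
pose M1 : 'M[{poly F}]_(1 + n) :=
  tperm_mx 0 i0 *m M0 *m tperm_mx 0 j0.
have tperm_mxK m (a b : 'I_m) : tperm_mx a b *m tperm_mx a b = 1%:M :> 'M[{poly F}]_m.
  by rewrite -perm_mxM tperm2 perm_mx1.
have M1E : M1 0 0 = M0 i0 j0.
  by rewrite /M1 -xcolE -xrowE !mxE !tpermL.
pose u := ulsubmx M1 0 0; pose r := ursubmx M1; pose c := dlsubmx M1.
pose D := drsubmx M1; pose M2 := u *: D - c *m r.
have M1bl : M1 = block_mx u%:M r c D.
  rewrite -[LHS]submxK; congr block_mx.
  by apply/matrixP => i j; rewrite !ord1 [RHS]mxE eqxx mulr1n.
have uE : u = M0 i0 j0.
  have ul (X : 'M[{poly F}]_(1 + n)) : ulsubmx X 0 0 = X 0 0.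
    by rewrite !mxE; congr (X _ _); apply/val_inj.
  by rewrite -M1E /u ul.
have dvdM2 : 'X^((n * k).+1) %| \det ('X^d *: M2).
  (* The lower triangular factor clears the column [c] without dividing by the pivot; its
     determinant is [u ^+ n]. *)
  have detM1 : u ^+ n * \det M1 = u * \det M2.
    have <- : \det (block_mx 1%:M 0 (- c) u%:M) = u ^+ n :> {poly F}.
      by rewrite det_lblock det1 mul1r det_scalar.
    rewrite -det_mulmx M1bl mulmx_block !mul0mx !mul1mx !addr0.
    rewrite mul_mx_scalar mul_scalar_mx scalerN addNr det_ublock det_scalar1.
    by congr (_ * \det _); rewrite mul_scalar_mx mulNmx addrC.
  have detM0 : 'X^((n.+1 * k).+1) %| 'X^(n.+1 * d) * \det M1.
    rewrite /M1 !det_mulmx mulrA dvdp_mulr // mulrCA dvdp_mull //.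
    by move: detM; rewrite ME detZ -exprM [(d * _)%N]mulnC.
  have : 'X^((n.+1 * k).+1) %| u * ('X^d * \det ('X^d *: M2)).
    have -> : u * ('X^d * \det ('X^d *: M2)) = u ^+ n * ('X^(n.+1 * d) * \det M1).
      rewrite detZ -exprM [RHS]mulrCA detM1 mulrCA [u * (_ * _)]mulrCA mulrA -exprD.
      by rewrite -mulnS mulnC.
    by rewrite dvdp_mull.
  (* Since u(0) <> 0, [u] is prime to X and cancels. Then ['X^d] cancels, and d <= k leaves at least
     the exponent [(n * k).+1] of the induction hypothesis. *)
  rewrite Gauss_dvdpr; last by rewrite coprimep_Xn // uE.
  move=> dvdN; rewrite -(dvdp_mul2l _ _ (monic_neq0 (monicXn F d))).
  apply: dvdp_trans dvdN; rewrite -exprD dvdp_exp2l //.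
  by rewrite mulSn addnS ltnS leq_add2r.
have [v2 v2P [i v2i]] := IH _ dvdM2.
(* Lift of [v2]: the pivot row of [M1] kills it, and the other rows give [M2 *m v2]. *)
pose v1 : 'cV[{poly F}]_(1 + n) := col_mx (- (r *m v2)) (u *: v2).
have M1v : M1 *m v1 = col_mx 0 (M2 *m v2).
  rewrite M1bl mul_block_col mul_scalar_mx mulmxN; congr col_mx.
    by rewrite scalerN -scalemxAr addNr.
  by rewrite mulmxBl mulmxA -scalemxAr -scalemxAl addrC.
exists (tperm_mx 0 j0 *m v1).
  have -> : M *m (tperm_mx 0 j0 *m v1) = tperm_mx 0 i0 *m ('X^d *: (M1 *m v1)).
    by rewrite /M1 -scalemxAr ME -scalemxAl !mulmxA tperm_mxK mul1mx.
  apply: mxdvd_mull; rewrite M1v scale_col_mx scaler0 scalemxAl.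
  move/mxdvdP: v2P => v2P; apply/mxdvdP => a b; rewrite mxE.
  by case: (@fintype.split 1 n a) => a'; [rewrite mxE dvdp0 | exact: v2P].
exists (tperm 0 j0 (rshift 1 i)).
have v1i : v1 (rshift 1 i) 0 = u * v2 i 0 by rewrite col_mxEd mxE.
by rewrite -xrowE mxE tpermK [v1 _ _]v1i hornerM mulf_neq0 // uE.
Qed.
End KernelVector.

(** * Coefficients of characteristic polynomials *)

Section FunctionRing.
Variables (T : Type) (F : comNzRingType) (S : (T -> F) -> Prop).
Hypothesis S_cst : forall c, S (fun=> c).
Hypothesis SD : forall f g, S f -> S g -> S (fun t => f t + g t).
Hypothesis SM : forall f g, S f -> S g -> S (fun t => f t * g t).
Hypothesis S_ext : forall f g, f =1 g -> S f -> S g.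

Let Sp (p : T -> {poly F}) := forall k, S (fun t => (p t)`_k).

Let S_sum I (r : seq I) (P : pred I) (f : I -> T -> F) :
  (forall i, S (f i)) -> S (fun t => \sum_(i <- r | P i) f i t).
Proof.
move=> Sf; elim: r => [|i r IH].
  by apply: S_ext (S_cst 0) => t; rewrite big_nil.
have [Pi|nPi] := boolP (P i).
  by apply: S_ext (SD (Sf i) IH) => t; rewrite big_cons Pi.
by apply: S_ext IH => t; rewrite big_cons (negPf nPi).
Qed.

Let SpM p q : Sp p -> Sp q -> Sp (fun t => p t * q t).
Proof.
move=> Spp Spq k; apply: (@S_ext (fun t =>
    \sum_(i < k.+1) (p t)`_i * (q t)`_(k - i))) => [t|].
  by rewrite coefM.
by apply: S_sum => i; apply: SM.
Qed.

(** These coefficients are integer polynomials in the entries, so a property stable under constants,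
    sums and products passes to them. Later [S] is a congruence, differentiability at a point,
    agreement of jets, or convergence along a filter. *)
Lemma char_poly_closed n (A : T -> 'M[F]_n) :
  (forall i j, S (fun t => A t i j)) ->
  forall k, S (fun t => (char_poly (A t))`_k).
Proof.
move=> SA k; rewrite /char_poly /determinant.
apply: (@S_ext (fun t => \sum_(s : 'S_n)
    ((-1) ^+ s * \prod_i char_poly_mx (A t) i (s i))`_k)) => [t|].
  by rewrite coef_sum.
apply: S_sum => s; move: k; apply: SpM => [k|]; first exact: S_cst.
elim: (index_enum _) => [|i r IH] k.
  by apply: S_ext (S_cst (1 : {poly F})`_k) => t; rewrite big_nil.
apply: (@S_ext (fun t => (char_poly_mx (A t) i (s i) *
    \prod_(j <- r) char_poly_mx (A t) j (s j))`_k)) => [t|].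
  by rewrite big_cons.
move: k; apply: SpM => // k.
apply: (@S_ext (fun t => ('X *+ (i == s i))`_k +
    (- ((k == 0)%N)%:R) * A t i (s i))) => [t|].
  rewrite !mxE coefB coefC; case: (k == 0)%N; first by rewrite mulN1r.
  by rewrite !oppr0 mul0r.
by apply: SD => //; apply: SM.
Qed.

End FunctionRing.

(** * Isospectral polynomial curves with a prescribed 1-jet *)

Definition pcongr (F : fieldType) (d : {poly F}) (p q : {poly {poly F}}) :=
  forall k, d %| p`_k - q`_k.

Section Curve.
Variable F : closedFieldType.
Implicit Type d : {poly F}.

Lemma char_poly_congr d n (A B : 'M[{poly F}]_n) :
  mxdvd d (A - B) -> pcongr d (char_poly A) (char_poly B).
Proof.
move=> /mxdvdP dAB k.
(* The pair of matrices is one function on [bool], and [S] says that the two values are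
   congruent. *)
pose M (b : bool) := if b then A else B.
apply: (@char_poly_closed bool _ (fun f => d %| f true - f false) _ _ _ _ n M).
- by move=> c; rewrite subrr dvdp0.
- by move=> f g df dg; rewrite opprD addrACA dvdp_add.
- move=> f g df dg.
  have -> : f true * g true - f false * g false =
      (f true - f false) * g true + f false * (g true - g false).
    by rewrite mulrBl mulrBr addrA subrK.
  by apply: dvdp_add; [exact: dvdp_mulr | exact: dvdp_mull].
- by move=> f g fg; rewrite !fg.
by move=> i j; move: (dAB i j); rewrite !mxE.
Qed.

Lemma pcongr_sym d p q : pcongr d p q -> pcongr d q p.
Proof. by move=> pq k; rewrite -dvdpNr opprB. Qed.

Lemma pcongr_trans d q p r : pcongr d p q -> pcongr d q r -> pcongr d p r.
Proof. by move=> pq qr k; rewrite -(subrKA q`_k) dvdp_add. Qed.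

Lemma pcongr_dvd e d p q : e %| d -> pcongr d p q -> pcongr e p q.
Proof. by move=> ed pq k; apply: dvdp_trans ed (pq k). Qed.

Lemma pcongr_horner d p q x : pcongr d p q -> d %| p.[x] - q.[x].
Proof.
move=> pq; rewrite -hornerN -hornerD horner_coef.
by apply: dvdp_sumr => i _; rewrite coefB dvdp_mulr.
Qed.

(** The coefficients of r = p - q satisfy r_k = a r_(k+1) modulo d and vanish from the size of r on;
    descending induction applies. *)
Lemma pcongr_cancel d (a : {poly F}) p q :
  pcongr d (('X - a%:P) * p) (('X - a%:P) * q) -> pcongr d p q.
Proof.
move=> pq k; set r := p - q.
have dr k' : d %| r`_k' - a * r`_k'.+1.
  have := pq k'.+1; rewrite -coefB -mulrBr -/r mulrBl coefB coefXM coefCM.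
  by [].
rewrite -coefB -/r.
suff H j i : (size r <= i + j)%N -> d %| r`_i.
  by apply: (H (size r)); rewrite leq_addl.
elim: j i => [|j IH] i; first by rewrite addn0 => /leq_sizeP ->; rewrite ?dvdp0.
rewrite addnS -addSn => /IH dri.
by rewrite -(subrK (a * r`_i.+1) r`_i) dvdp_add ?dvdp_mull.
Qed.

Lemma det_horner_char_poly n (P : 'M[{poly F}]_n) (a : {poly F}) :
  \det (a%:M - P) = (char_poly P).[a].
Proof.
rewrite /char_poly -horner_evalE -det_map_mx; congr (\det _).
apply/matrixP => i j; rewrite !mxE /= horner_evalE.
by rewrite hornerD hornerN hornerMn hornerX hornerC.
Qed.

Lemma char_poly_ublock n (a : {poly F}) (b : 'rV_n) (D : 'M[{poly F}]_n) :
  char_poly (block_mx a%:M b 0 D : 'M[{poly F}]_(1 + n)) = ('X - a%:P) * char_poly D.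
Proof.
rewrite /char_poly /char_poly_mx map_block_mx /= map_scalar_mx /= map_mx0.
rewrite (scalar_mx_block 1 n) opp_block_mx add_block_mx oppr0 !add0r.
by rewrite det_ublock -raddfB det_scalar1.
Qed.

Lemma char_poly_sim n (P E E' : 'M[{poly F}]_n) : E *m E' = 1%:M ->
  char_poly (E *m P *m E') = char_poly P.
Proof.
move=> EE'; rewrite /char_poly.
have EE'C : map_mx polyC E *m map_mx polyC E' = 1%:M.
  by rewrite -map_mxM EE' map_mx1.
have -> : char_poly_mx (E *m P *m E') =
    map_mx polyC E *m char_poly_mx P *m map_mx polyC E'.
  rewrite /char_poly_mx mulmxBr mulmxBl !map_mxM /= scalar_mxC.
  by rewrite -(mulmxA 'X%:M) EE'C mulmx1.
by rewrite !det_mulmx mulrC mulrA -det_mulmx (mulmx1C EE'C) det1 mul1r.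
Qed.

(** A Bezout relation t v_i + w X^(k+1) = 1 brings the entry [i] of [t *: v] to exactly 1 by adding
    a multiple of X^(k+1), which does not affect the divisibility. *)
Lemma normalized_kernel_vector k n (M : 'M[{poly F}]_n) :
  'X^((n * k).+1) %| \det M ->
  exists i (v : 'cV[{poly F}]_n), v i 0 = 1 /\ mxdvd 'X^(k.+1) (M *m v).
Proof.
move=> /kernel_vector[v Mv [i vi0]].
have /Bezout_eq1_coprimepP[[w t] /= wt] := coprimep_Xn k.+1 vi0.
exists i, (t *: v + (w * 'X^(k.+1)) *: delta_mx i 0); split.
  by rewrite !mxE !eqxx mulr1 addrC.
rewrite mulmxDr -!scalemxAr mxdvdD //.
  by move/mxdvdP: Mv => Mv; apply/mxdvdP => a b; rewrite mxE dvdp_mull.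
by apply/mxdvdP => a b; rewrite mxE dvdp_mulr // dvdp_mull.
Qed.

(** Splitting off one eigenvalue lowers the exponent from 2 (n+1)! to 2 n!. It never drops below 2,
    which preserves the 1-jet. *)
Theorem isospectral_curve_of_jet n (P : 'M[{poly F}]_n) (chi : {poly F}) :
  chi \is monic -> size chi = n.+1 ->
  pcongr 'X^(2 * n`!) (char_poly P) (map_poly polyC chi) ->
  exists2 Psi : 'M[{poly F}]_n,
    mxdvd 'X^2 (Psi - P) & char_poly Psi = map_poly polyC chi.
Proof.
elim: n P chi => [|n IH] P chi chi_monic size_chi Pchi.
  exists P; first by apply/mxdvdP => -[].
  have -> : chi = 1.
    by move/monicP: chi_monic; rewrite [chi]size1_polyC ?size_chi // lead_coefC => ->.
  by rewrite rmorph1 /char_poly det_mx00.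
have /closed_rootP[a /factor_theorem[chi1 chiE]] : size chi != 1 by rewrite size_chi.
have chi1_monic : chi1 \is monic.
  by move: chi_monic; rewrite chiE monicMr // monicXsubC.
have size_chi1 : size chi1 = n.+1.
  move: size_chi; rewrite chiE size_Mmonic ?monicXsubC ?monic_neq0 //.
  by rewrite size_XsubC addn2 /= => -[].
have Echi : map_poly polyC chi = ('X - a%:P%:P) * map_poly polyC chi1.
  by rewrite chiE rmorphM rmorphB /= map_polyX map_polyC mulrC.
(* The recursion needs precision k + 1 = 2 n!. The kernel vector lemma then asks for (n+1) k + 1, at
   most (n+1) (k+1) = 2 (n+1)!. *)
have [k mE] : exists k, (2 * n`!)%N = k.+1.
  by exists (2 * n`!).-1; rewrite prednK // muln_gt0 fact_gt0.
have dvdN : 'X^((n.+1 * k).+1) %| ('X^(2 * (n.+1)`!) : {poly F}).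
  rewrite dvdp_exp2l // factS mulnCA mE mulnS.
  by rewrite addSn ltnS leq_addl.
have /normalized_kernel_vector[i0 [v [vi Pv]]] :
    'X^((n.+1 * k).+1) %| \det (a%:P%:M - P).
  rewrite det_horner_char_poly.
  have := pcongr_horner a%:P (pcongr_dvd dvdN Pchi).
  by rewrite Echi hornerM hornerXsubC subrr mul0r subr0.
pose T : 'M[{poly F}]_(1 + n) := tperm_mx 0 i0.
have TT : T *m T = 1%:M by rewrite -perm_mxM tperm2 perm_mx1.
pose c : 'cV[{poly F}]_n := dsubmx (T *m v : 'cV_(1 + n)).
have TvE : T *m v = col_mx 1%:M c.
  rewrite -[LHS]vsubmxK; congr col_mx; apply/matrixP => i j.
  rewrite !ord1 mxE -xrowE mxE.
  have -> : lshift n 0 = 0 :> 'I_(1 + n) by apply/val_inj.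
  by rewrite tpermL vi mxE eqxx.
(* [T] swaps the entry 1 of [v] to the first place, and the first column of the
   unipotent matrix [E] is [T *m v]. *)
pose E : 'M[{poly F}]_(1 + n) := block_mx 1%:M 0 c 1%:M.
pose E' : 'M[{poly F}]_(1 + n) := block_mx 1%:M 0 (- c) 1%:M.
have EE' : E *m E' = 1%:M.
  rewrite mulmx_block !mul1mx !mul0mx !mulmx1 !mulmx0 !addr0 !add0r subrr.
  by rewrite -scalar_mx_block.
have E'E := mulmx1C EE'.
pose G := T *m E; pose G' := E' *m T.
have GG' : G *m G' = 1%:M by rewrite /G mulmxA -(mulmxA T) EE' mulmx1 TT.
have G'G := mulmx1C GG'.
(* [G] sends [e] to [v], so modulo X^(k+1) the conjugate [P1] has eigenvector [e] for the eigenvalue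
   [a]. *)
pose e : 'cV[{poly F}]_(1 + n) := col_mx 1%:M 0.
have Ge : G *m e = v.
  rewrite /G /e -mulmxA mul_block_col !mul1mx !mulmx0 mulmx1 !addr0 -TvE.
  by rewrite mulmxA TT mul1mx.
clearbody G G'.
pose P1 : 'M[{poly F}]_(1 + n) := G' *m P *m G.
have GP1 : P = G *m P1 *m G'.
  by rewrite /P1 -(mulmxA G') (mulmxA G) GG' mul1mx -mulmxA GG' mulmx1.
have chiP1 : char_poly P1 = char_poly P by rewrite /P1 char_poly_sim.
pose D := drsubmx P1; pose b := ursubmx P1.
have P1e : mxdvd 'X^(k.+1) (P1 *m e - a%:P%:M *m e).
  have {2}-> : e = G' *m v by rewrite -Ge mulmxA G'G mul1mx.
  rewrite /P1 -mulmxA Ge -scalar_mxC -!mulmxA -mulmxBr; apply: mxdvd_mull.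
  by rewrite scalar_mxC -mulmxBl -opprB mulNmx; apply: mxdvdN.
(* [P1] with its first column replaced by [a] times [e]. *)
pose Q : 'M[{poly F}]_(1 + n) := block_mx a%:P%:M b 0 D.
have P1Q : mxdvd 'X^(k.+1) (P1 - Q).
  have -> : P1 - Q = (P1 *m e - a%:P%:M *m e) *m row_mx 1%:M 0.
    rewrite -[P1]submxK /Q /e (scalar_mx_block 1 n) !mul_block_col.
    rewrite !opp_block_mx !add_block_mx !opp_col_mx !add_col_mx !mulmx0 !mul0mx.
    rewrite !mulmx1 !addr0 !subrr !subr0 mul_col_row !mulmx1 !mulmx0.
    by [].
  exact: mxdvd_mulr.
(* Modulo X^(k+1), X - a times the characteristic polynomial of [D] is that of [Q], hence that of
   [P], hence X - a times [chi1]; the factor X - a cancels. *)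
have [|Psi1 Psi1D Psi1chi] := IH D chi1 chi1_monic size_chi1.
  rewrite mE; apply: (@pcongr_cancel _ a%:P).
  rewrite -(char_poly_ublock _ b) -Echi.
  apply: pcongr_trans (pcongr_dvd _ Pchi); last first.
    apply: dvdp_trans dvdN; apply: dvdp_exp2l; rewrite ltnS.
    exact: (leq_pmull k (ltn0Sn n)).
  by rewrite -chiP1; apply/pcongr_sym/char_poly_congr.
exists (G *m block_mx a%:P%:M b 0 Psi1 *m G').
  rewrite GP1 -mulmxBl -mulmxBr; apply/mxdvd_mulr/mxdvd_mull.
  (* The lower block changes by [Psi1 - D], divisible by X^2 by induction; [Q - P1] is divisible by
     X^(2 n!). *)
  rewrite -[X in mxdvd _ X](subrKA Q); apply: mxdvdD.
    rewrite /Q opp_block_mx add_block_mx !subrr.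
    have -> : block_mx 0 0 0 (Psi1 - D) =
        col_mx 0 1%:M *m (Psi1 - D) *m row_mx 0 1%:M :> 'M[{poly F}]_(1 + n).
      by rewrite mul_col_mx mul1mx mul0mx mul_col_row !mulmx0 !mulmx1.
    exact/mxdvd_mulr/mxdvd_mull.
  rewrite -opprB; apply: mxdvdN; apply: mxdvd_trans P1Q.
  by apply: dvdp_exp2l; rewrite -mE; exact: (leq_pmulr 2 (fact_gt0 n)).
rewrite (char_poly_sim _ GG') char_poly_ublock Psi1chi.
exact: esym Echi.
Qed.

End Curve.

(** * Complex-valued functions of a real variable *)

Section Modulus.
Variable R : realType.
Implicit Types x y z : Cplx R.

Lemma normE x : `|x| = (normc x)%:C.
Proof. by case: x. Qed.

Lemma normc_ge0 x : 0 <= normc x.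
Proof. by case: x => a b /=; rewrite sqrtr_ge0. Qed.

Lemma ler_normcD x y : normc (x + y) <= normc x + normc y.
Proof. exact: le_normcD. Qed.

Lemma ler_normcB x y : normc (x - y) <= normc x + normc y.
Proof. by rewrite (le_trans (ler_normcD _ _)) // -(normcN y). Qed.

Lemma normcB x y : normc (x - y) = normc (y - x).
Proof. by rewrite -(normcN (x - y)); congr normc; exact: opprB. Qed.

Lemma normcX x n : normc (x ^+ n) = normc x ^+ n.
Proof.
elim: n => [|n IH]; first by rewrite !expr0 normc1.
by rewrite !exprS normcM IH.
Qed.

Lemma normc_Re x : `|Re x| <= normc x.
Proof. by rewrite -lecR -normE; exact: normc_ge_Re. Qed.

Lemma normc_Im x : `|Im x| <= normc x.
Proof.
case: x => a b /=; rewrite -sqrtr_sqr ler_sqrt ?addr_ge0 ?sqr_ge0 //.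
by rewrite lerDr sqr_ge0.
Qed.

Lemma normc_leD x : normc x <= `|Re x| + `|Im x|.
Proof.
case: x => a b /=; rewrite -[leRHS]ger0_norm ?addr_ge0 //.
rewrite -sqrtr_sqr ler_sqrt ?sqr_ge0 // sqrrD !real_normK ?num_real //.
by rewrite lerD2r lerDl mulrn_wge0 ?mulr_ge0.
Qed.

Lemma normc_real (r : R) : normc (r%:C : Cplx R) = `|r|.
Proof. by rewrite /= expr0n addr0 sqrtr_sqr. Qed.

End Modulus.

(** * Primitives of complex-valued functions *)

Section Primitive.
Variable R : realType.

Lemma continuous_primitive (f : R -> R) (c : R) : continuous f ->
  exists F : R -> R, forall x, c < x -> is_derive x 1 F (f x).
Proof.
move=> cf; exists (fun x => \int[lebesgue_measure]_(t in `[c, x]) f t).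
move=> x cx.
have fi : lebesgue_measure.-integrable `[c, x + 1] (EFin \o f).
  apply: continuous_compact_integrable; first exact: segment_compact.
  exact: continuous_subspaceT.
have [|dF dFE] := continuous_FTC1_closed _ fi cx (cf x); first by rewrite ltrDl.
by apply: DeriveDef; rewrite -?derive1E.
Qed.

Lemma mean_value_bound (F f : R -> R) (a b M : R) : a <= b ->
  (forall x, a <= x <= b -> is_derive x 1 F (f x)) ->
  (forall x, a <= x <= b -> `|f x| <= M) ->
  `|F b - F a| <= M * (b - a).
Proof.
move=> ab dF fM.
have [||c /[!in_itv]/= cab ->] := @MVT_segment R F f a b ab.
- by move=> x; rewrite in_itv /= => /andP[ax xb]; apply: dF; rewrite !ltW.
- apply: derivable_within_continuous => x; rewrite in_itv /= => /dF[].
  by [].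
by rewrite normrM (ger0_norm (_ : 0 <= b - a)) ?subr_ge0 // ler_wpM2r ?subr_ge0 ?fM.
Qed.

(* [R[i]] is not a normed module over [R] in the library, whence the derivatives
   of the two components. Primitives are only required to the right of [c]
   because the fundamental theorem of calculus is stated with a left endpoint. *)
Definition cprim (c : R) (F f : R -> Cplx R) :=
  forall x, c < x -> is_derive x 1 (fun t => Re (F t)) (Re (f x)) /\
                     is_derive x 1 (fun t => Im (F t)) (Im (f x)).

Lemma cprim_exists c (f : R -> Cplx R) :
  continuous (fun t => Re (f t)) -> continuous (fun t => Im (f t)) ->
  exists F, cprim c F f.
Proof.
move=> /(continuous_primitive c)[F1 F1E] /(continuous_primitive c)[F2 F2E].
by exists (fun t => F1 t +i* F2 t) => x cx; split; [exact: F1E|exact: F2E].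
Qed.

Lemma cprimD c F f G g : cprim c F f -> cprim c G g ->
  cprim c (fun t => F t + G t) (fun t => f t + g t).
Proof.
move=> Ff Gg x cx; have [FR FI] := Ff x cx; have [GR GI] := Gg x cx; split.
  rewrite raddfD /=; under [X in is_derive _ _ X _]eq_fun do rewrite raddfD /=.
  exact: is_deriveD.
rewrite raddfD /=; under [X in is_derive _ _ X _]eq_fun do rewrite raddfD /=.
exact: is_deriveD.
Qed.

Lemma cReM (x y : Cplx R) : Re (x * y) = Re x * Re y - Im x * Im y.
Proof. by case: x y => a b []. Qed.

Lemma cImM (x y : Cplx R) : Im (x * y) = Re x * Im y + Im x * Re y.
Proof. by case: x y => a b []. Qed.

Lemma cprimZ c (k : Cplx R) F f : cprim c F f ->
  cprim c (fun t => k * F t) (fun t => k * f t).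
Proof.
move=> Ff x cx; have [FR FI] := Ff x cx; split.
  rewrite cReM; under [X in is_derive _ _ X _]eq_fun do rewrite cReM.
  by apply: is_deriveB.
rewrite cImM; under [X in is_derive _ _ X _]eq_fun do rewrite cImM.
exact: is_deriveD.
Qed.

Lemma cprimB c F f G g : cprim c F f -> cprim c G g ->
  cprim c (fun t => F t - G t) (fun t => f t - g t).
Proof.
move=> Ff Gg x cx; have [FR FI] := Ff x cx; have [GR GI] := Gg x cx; split.
  rewrite raddfB /=; under [X in is_derive _ _ X _]eq_fun do rewrite raddfB /=.
  exact: is_deriveB.
rewrite raddfB /=; under [X in is_derive _ _ X _]eq_fun do rewrite raddfB /=.
exact: is_deriveB.
Qed.

(** The mean value theorem is applied to the real and imaginary parts separately; this costs the
    factor 2, which persists in the later integral estimates. *)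
Lemma cprim_bound c F f a b M : c < a -> a <= b -> cprim c F f ->
  (forall x, a <= x <= b -> normc (f x) <= M) ->
  normc (F b - F a) <= 2 * M * (b - a).
Proof.
move=> ca ab Ff fM; rewrite (le_trans (normc_leD _)) // !raddfB /=.
rewrite -mulrA mulr2n mulrDl !mul1r lerD //.
  apply: (@mean_value_bound (fun t => Re (F t)) (fun t => Re (f t)))
    => // x /andP[ax xb].
    by have [] := Ff x (lt_le_trans ca ax).
  by rewrite (le_trans (normc_Re _)) ?fM ?ax.
apply: (@mean_value_bound (fun t => Im (F t)) (fun t => Im (f t)))
  => // x /andP[ax xb].
  by have [] := Ff x (lt_le_trans ca ax).
by rewrite (le_trans (normc_Im _)) ?fM ?ax.
Qed.

End Primitive.

(** * Cauchy's formula *)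

Section MixedDifference.
Variable R : realType.

Lemma nested_intervals (lo hi : nat -> R) :
  (forall k, lo k <= lo k.+1) -> (forall k, hi k.+1 <= hi k) ->
  (forall k, lo k <= hi k) -> exists x, forall k, lo k <= x <= hi k.
Proof.
move=> lo_nd hi_ni lohi.
have lo_homo : {homo lo : i j / (i <= j)%N >-> i <= j}.
  by apply: homo_leq => // ? ? ?; exact: le_trans.
have hi_homo : {homo hi : i j / (i <= j)%N >-> j <= i}.
  by apply: (@homo_leq _ hi (fun x y => y <= x)) => // x y z xy /le_trans; apply.
have lohij i j : lo i <= hi j.
  have [ij|/ltnW ji] := leqP i j; first exact: le_trans (lo_homo _ _ ij) _.
  exact: le_trans (lohi i) (hi_homo _ _ ji).
have lo_sup : has_sup (range lo).
  by split; [exists (lo 0%N), 0%N|exists (hi 0%N) => _ [i _ <-]].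
exists (sup (range lo)) => k; apply/andP; split.
  by apply: ub_le_sup; [case: lo_sup|exists k].
by apply: ge_sup; [case: lo_sup|move=> _ [i _ <-]].
Qed.

Lemma exists_expn2_ge (x : R) : exists k, x <= 2 ^+ k.
Proof.
exists (Num.truncn `|x|).+1; apply: le_trans (ler_norm _) _.
have /andP[_ /ltW/le_trans] := truncn_itv (normr_ge0 x); apply.
by rewrite -natrX ler_nat ltnW // ltn_expl.
Qed.

(* When A(-, t) and B(s, -) are primitives of the coefficients of the 1-form
   U ds + V dt, the mixed difference of B - A is the integral of the form around
   the rectangle [s1, s2] x [t1, t2]. *)
Definition mixed_diff (D : R -> R -> Cplx R) (s1 s2 t1 t2 : R) : Cplx R :=
  D s2 t2 - D s2 t1 - D s1 t2 + D s1 t1.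

Lemma mixed_diff_split (D : R -> R -> Cplx R) s1 s s2 t1 t t2 :
  mixed_diff D s1 s2 t1 t2 =
  (mixed_diff D s1 s t1 t + mixed_diff D s s2 t1 t) +
  (mixed_diff D s1 s t t2 + mixed_diff D s s2 t t2).
Proof. by rewrite /mixed_diff; ring. Qed.

(** Goursat's bisection: by additivity, some quarter of a rectangle carries at least a fourth of the
    mixed difference. The nested rectangles shrink to a point, where the local bound, quadratic in
    the sides, contradicts the lower bound [e0 / 4 ^+ k]. *)
Lemma mixed_diff_eq0 (D : R -> R -> Cplx R) (a w b h : R) :
  0 < w -> 0 < h ->
  (forall x y, a <= x <= a + w -> b <= y <= b + h ->
    forall e, 0 < e -> exists2 d, 0 < d &
    forall s1 s2 t1 t2, a <= s1 <= x -> x <= s2 <= a + w ->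
      b <= t1 <= y -> y <= t2 <= b + h -> s2 - s1 <= d -> t2 - t1 <= d ->
      normc (mixed_diff D s1 s2 t1 t2) <= e * ((s2 - s1) + (t2 - t1)) ^+ 2) ->
  mixed_diff D a (a + w) b (b + h) = 0.
Proof.
move=> w0 h0 loc; apply: eq0_normc; apply/eqP; rewrite eq_le normc_ge0 andbT.
rewrite leNgt; apply/negP; set e0 := normc _ => e0_gt0.
pose W k : R := w / 2 ^+ k; pose H k : R := h / 2 ^+ k.
have p2 k : 0 < 2 ^+ k :> R by rewrite exprn_gt0.
have W0 k : 0 < W k by rewrite divr_gt0.
have H0 k : 0 < H k by rewrite divr_gt0.
have WS k : W k = W k.+1 + W k.+1 by rewrite /W exprS; field; exact: lt0r_neq0.
have HS k : H k = H k.+1 + H k.+1 by rewrite /H exprS; field; exact: lt0r_neq0.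
pose bad k (p : R * R) := [/\ a <= p.1, p.1 + W k <= a + w, b <= p.2,
  p.2 + H k <= b + h &
  e0 / 4 ^+ k <= normc (mixed_diff D p.1 (p.1 + W k) p.2 (p.2 + H k))].
(* The implication makes the choice function total; a corner that is not [bad] is sent to itself. *)
have /choice[g gP] : forall kp : nat * (R * R), exists q : R * R,
    bad kp.1 kp.2 -> [/\ bad kp.1.+1 q,
      kp.2.1 <= q.1, q.1 + W kp.1.+1 <= kp.2.1 + W kp.1,
      kp.2.2 <= q.2 & q.2 + H kp.1.+1 <= kp.2.2 + H kp.1].
  move=> [k [s t]] /=.
  have [B|nB] := pselect (bad k (s, t)); last by exists (s, t).
  suff [q ?] : exists q : R * R, [/\ bad k.+1 q,
      s <= q.1, q.1 + W k.+1 <= s + W k,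
      t <= q.2 & q.2 + H k.+1 <= t + H k] by exists q.
  case: B => /= sa sw tb th.
  rewrite (mixed_diff_split D s (s + W k.+1) _ t (t + H k.+1)).
  have -> : s + W k = s + W k.+1 + W k.+1 by rewrite WS addrA.
  have -> : t + H k = t + H k.+1 + H k.+1 by rewrite HS addrA.
  set m1 := mixed_diff _ _ _ _ _; set m2 := mixed_diff _ _ _ _ _.
  set m3 := mixed_diff _ _ _ _ _; set m4 := mixed_diff _ _ _ _ _ => le_e.
  have {le_e} : e0 / 4 ^+ k <= normc m1 + normc m2 + (normc m3 + normc m4).
    apply: le_trans le_e _; apply: le_trans (ler_normcD _ _) _.
    by rewrite lerD ?ler_normcD.
  have -> : e0 / 4 ^+ k = e0 / 4 ^+ k.+1 * 4.
    by rewrite exprS; field; rewrite lt0r_neq0 ?exprn_gt0.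
  have := W0 k.+1; have := H0 k.+1; have := WS k; have := HS k.
  move: sa sw tb th => /= sa sw tb th HE WE Hp Wp le_e.
  have [l1|l1] := leP (e0 / 4 ^+ k.+1) (normc m1).
    by exists (s, t); do ?split => //=; lra.
  have [l2|l2] := leP (e0 / 4 ^+ k.+1) (normc m2).
    by exists (s + W k.+1, t); do ?split => //=; lra.
  have [l3|l3] := leP (e0 / 4 ^+ k.+1) (normc m3).
    by exists (s, t + H k.+1); do ?split => //=; lra.
  have [l4|l4] := leP (e0 / 4 ^+ k.+1) (normc m4).
    by exists (s + W k.+1, t + H k.+1); do ?split => //=; lra.
  by exfalso; lra.
pose p := fix p k := if k is k'.+1 then g (k', p k') else (a, b).
have pbad k : bad k (p k).
  elim: k => [|k IH]; last by have [] := gP (k, p k) IH.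
  split; rewrite /= /W /H ?expr0 ?divr1 //.
have pS k := gP (k, p k) (pbad k).
have [||k|x xP] := @nested_intervals (fun k => (p k).1) (fun k => (p k).1 + W k).
- by move=> k; have [] := pS k.
- by move=> k; have [] := pS k.
- by rewrite lerDl ltW.
have [||k|y yP] := @nested_intervals (fun k => (p k).2) (fun k => (p k).2 + H k).
- by move=> k; have [] := pS k.
- by move=> k; have [] := pS k.
- by rewrite lerDl ltW.
have wh0 : 0 < w + h by rewrite addr_gt0.
(* The sides at stage k add up to (w + h) / 2^k, so this constant makes the local bound half of
   [e0 / 4 ^+ k]. *)
have [|||d d0 dP] := loc x y _ _ (e0 / (2 * (w + h) ^+ 2)).
- by have := xP 0%N; rewrite /= /W expr0 divr1.
- by have := yP 0%N; rewrite /= /H expr0 divr1.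
- by rewrite divr_gt0 // mulr_gt0 // exprn_gt0.
have [k kP] := exists_expn2_ge ((w + h) / d).
have WHd : W k + H k <= d.
  rewrite /W /H -mulrDl ler_pdivrMr // mulrC.
  by rewrite -ler_pdivrMr.
have [a1 a2 b1 b2 le_e] := pbad k.
have Wk := W0 k; have Hk := H0 k.
have := dP (p k).1 ((p k).1 + W k) (p k).2 ((p k).2 + H k).
have /andP[-> ->] := xP k; have /andP[-> ->] := yP k.
rewrite a1 a2 b1 b2 /= => /(_ isT isT isT isT).
have -> : (p k).1 + W k - (p k).1 = W k by ring.
have -> : (p k).2 + H k - (p k).2 = H k by ring.
have -> : e0 / (2 * (w + h) ^+ 2) * (W k + H k) ^+ 2 = e0 / 4 ^+ k / 2.
  rewrite /W /H -mulrDl expr_div_n -exprM mulnC exprM.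
  have -> : (2 ^+ 2 : R) = 4 by rewrite expr2; lra.
  field; rewrite (lt0r_neq0 wh0) /=.
  by rewrite lt0r_neq0 ?exprn_gt0.
have e4 : 0 < e0 / 4 ^+ k by rewrite divr_gt0 ?exprn_gt0.
have WHk : 0 < W k + H k by lra.
move=> /(_ _ _)/(le_trans le_e).
have -> : W k <= d by lra.
have -> : H k <= d by lra.
by move=> /(_ isT isT); lra.
Qed.

End MixedDifference.

(** * Complex differentiability, continuity and integrals over a period *)

Section Calculus.
Variable R : realType.
Implicit Types (f : Cplx R -> Cplx R) (g : R -> Cplx R).

Definition cderiv f (z l : Cplx R) := forall e : R, 0 < e ->
  exists2 d : R, 0 < d & forall h, normc h < d ->
    normc (f (z + h) - f z - l * h) <= e * normc h.

Lemma cderiv_continuous f z l : cderiv f z l -> forall e : R, 0 < e ->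
  exists2 d : R, 0 < d & forall h, normc h < d -> normc (f (z + h) - f z) <= e.
Proof.
move=> /(_ 1 ltr01)[d d0 dP] e e0.
have K0 : 0 < 1 + normc l by rewrite ltr_pwDl ?normc_ge0.
exists (Num.min d (e / (1 + normc l))); first by rewrite lt_min d0 divr_gt0.
move=> h; rewrite lt_min ltr_pdivlMr // => /andP[hd he].
rewrite -(subrK (l * h) (f _ - f z)) (le_trans (ler_normcD _ _)) //.
by rewrite normcM; have := dP _ hd; lra.
Qed.

(** Componentwise, as in [cprim]; [ccontP] gives the form with the modulus. *)
Definition ccont g :=
  continuous (fun t => Re (g t)) /\ continuous (fun t => Im (g t)).

Lemma ccontP g : ccont g <-> forall x (e : R), 0 < e ->
  exists2 d : R, 0 < d & forall y, `|y - x| < d -> normc (g y - g x) <= e.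
Proof.
split=> [[gR gI] x e e0|gP].
  have e2 : 0 < e / 2 by rewrite divr_gt0.
  have /cvgrPdist_le/(_ _ e2)[d1 /= d10 d1P] := gR x.
  have /cvgrPdist_le/(_ _ e2)[d2 /= d20 d2P] := gI x.
  exists (Num.min d1 d2); first by rewrite lt_min d10.
  move=> y; rewrite lt_min => /andP[y1 y2].
  rewrite normcB (le_trans (normc_leD _)) // (splitr e) !raddfB lerD //.
    by apply: d1P; rewrite /ball_ /= distrC.
  by apply: d2P; rewrite /ball_ /= distrC.
split=> x; apply/cvgrPdist_le => e e0; have [d d0 dP] := gP x e e0;
  exists d => //= y; rewrite /ball_ /= distrC => /dP yP; rewrite -raddfB.
  by rewrite (le_trans (normc_Re _)) // normcB.
by rewrite (le_trans (normc_Im _)) // normcB.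
Qed.

Lemma ccont_cst k : ccont (fun=> k).
Proof. by split=> x; exact: cvg_cst. Qed.

Lemma ccontD g h : ccont g -> ccont h -> ccont (fun t => g t + h t).
Proof.
move=> [gR gI] [hR hI]; split => x.
  under eq_fun do rewrite raddfD; apply: cvgD; [exact: gR|exact: hR].
under eq_fun do rewrite raddfD; apply: cvgD; [exact: gI|exact: hI].
Qed.

Lemma ccontM g h : ccont g -> ccont h -> ccont (fun t => g t * h t).
Proof.
move=> [gR gI] [hR hI]; split => x.
  under eq_fun do rewrite cReM.
  by apply: cvgB; apply: cvgM; [exact: gR|exact: hR|exact: gI|exact: hI].
under eq_fun do rewrite cImM.
by apply: cvgD; apply: cvgM; [exact: gR|exact: hI|exact: gI|exact: hR].
Qed.

Lemma ccontV g : ccont g -> (forall t, g t != 0) -> ccont (fun t => (g t)^-1).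
Proof.
move=> [gR gI] g0.
have ReV (x : Cplx R) : Re x^-1 = Re x / (Re x ^+ 2 + Im x ^+ 2) by case: x.
have ImV (x : Cplx R) : Im x^-1 = - (Im x / (Re x ^+ 2 + Im x ^+ 2)).
  by case: x.
have nz (x : Cplx R) : x != 0 -> Re x ^+ 2 + Im x ^+ 2 != 0.
  case: x => a b; apply: contra => /=.
  by rewrite paddr_eq0 ?sqr_ge0 // !sqrf_eq0 => /andP[/eqP-> /eqP->].
have cn x : {for x, continuous (fun t => (Re (g t) ^+ 2 + Im (g t) ^+ 2)^-1)}.
  apply: cvgV; first exact: nz.
  by apply: cvgD; apply: cvgM; [exact: gR|exact: gR|exact: gI|exact: gI].
split=> x.
  by under eq_fun do rewrite ReV; apply: cvgM; [exact: gR|exact: cn].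
by under eq_fun do rewrite ImV; apply: cvgN; apply: cvgM; [exact: gI|exact: cn].
Qed.

Lemma ccont_comp f g : ccont g -> (forall t, exists l, cderiv f (g t) l) ->
  ccont (fun t => f (g t)).
Proof.
move=> /ccontP gc fd; apply/ccontP => x e e0.
have [l /cderiv_continuous/(_ e e0)[d d0 dP]] := fd x.
have [d' d'0 d'P] := gc x (d / 2) (divr_gt0 d0 (ltr0Sn R 1)).
exists d' => // y /d'P yP.
have {1}-> : g y = g x + (g y - g x) by ring.
by apply: dP; apply: le_lt_trans yP _; lra.
Qed.

Lemma ccontX g n : ccont g -> ccont (fun t => g t ^+ n).
Proof.
move=> gc; elim: n => [|n IH]; first exact: ccont_cst.
by under eq_fun do rewrite exprS; exact: ccontM.
Qed.

Definition cis (t : R) : Cplx R := cos t +i* sin t.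

Lemma normc_cis t : normc (cis t) = 1.
Proof. by rewrite /= cos2Dsin2 sqrtr1. Qed.

Lemma ccont_cis : ccont cis.
Proof. by split=> x; [exact: continuous_cos|exact: continuous_sin]. Qed.

Lemma cprim_cis c : cprim c cis (fun t => 'i * cis t).
Proof.
move=> x _; rewrite cReM cImM /= !mul0r !mul1r sub0r add0r.
by split; [exact: is_derive_cos|exact: is_derive_sin].
Qed.

Lemma cis2pi : cis (2 * pi) = cis 0.
Proof.
rewrite /cis cos0 sin0 mulr2n mulrDl !mul1r; congr (_ +i* _).
  by rewrite -[pi + pi]mulr2n cos2pi.
by rewrite -[pi + pi]mulr2n sin2pi.
Qed.

Lemma cprim_cst c k : @cprim R c (fun=> k) (fun=> 0).
Proof. by move=> x _; split; exact: is_derive_cst. Qed.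

Lemma cprim_id c : @cprim R c (fun t => t%:C) (fun=> 1).
Proof. by move=> x _; split; [exact: is_derive_id|exact: is_derive_cst]. Qed.

Lemma cprim_expR c : @cprim R c (fun t => (expR t)%:C) (fun t => (expR t)%:C).
Proof. by move=> x _; split; [exact: is_derive_expR|exact: is_derive_cst]. Qed.

Lemma cprim_ext c F F' g g' : F =1 F' -> g =1 g' -> cprim c F g ->
  @cprim R c F' g'.
Proof. by move=> /funext-> /funext->. Qed.

Lemma cprim_exists_ccont c g : ccont g -> exists F, cprim c F g.
Proof. by move=> [gR gI]; exact: cprim_exists. Qed.

Lemma cprim_diff_eq c F G g h a b : c < a -> a <= b ->
  cprim c F g -> cprim c G h -> (forall x, a <= x <= b -> g x = h x) ->
  F b - F a = G b - G a.
Proof.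
move=> ca ab Fg Gh gh; apply/eqP; rewrite -subr_eq0; apply/eqP/eq0_normc/eqP.
rewrite eq_le normc_ge0 andbT.
have -> : F b - F a - (G b - G a) = (F b - G b) - (F a - G a) by ring.
rewrite (le_trans (cprim_bound (M := 0) ca ab (cprimB Fg Gh) _)) //.
  by move=> x /gh ->; rewrite subrr normc0.
by rewrite mulr0 mul0r.
Qed.

(* The integral of [g] over [0, 2 * pi]; it is [0] if [g] has no primitive. *)
Definition cint g : Cplx R :=
  let F := xget (fun=> 0) [set F | cprim (-1) F g] in F (2 * pi) - F 0.

Lemma cintE F g : cprim (-1) F g -> cint g = F (2 * pi) - F 0.
Proof.
move=> Fg; rewrite /cint; case: xgetP => [G _ Gg|/(_ F)//].
apply: cprim_diff_eq Gg Fg _ => //.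
by rewrite mulr_ge0 // pi_ge0.
Qed.

Lemma cintD g h : ccont g -> ccont h ->
  cint (fun t => g t + h t) = cint g + cint h.
Proof.
move=> /(cprim_exists_ccont (-1))[G Gg] /(cprim_exists_ccont (-1))[H Hh].
rewrite (cintE Gg) (cintE Hh) (cintE (cprimD Gg Hh)); ring.
Qed.

Lemma cintZ k g : ccont g -> cint (fun t => k * g t) = k * cint g.
Proof.
move=> /(cprim_exists_ccont (-1))[G Gg].
by rewrite (cintE Gg) (cintE (cprimZ k Gg)) mulrBr.
Qed.

Lemma cint_bound g M : ccont g -> (forall t, normc (g t) <= M) ->
  normc (cint g) <= 4 * pi * M.
Proof.
move=> /(cprim_exists_ccont (-1))[G Gg] gM; rewrite (cintE Gg).
have pi0 : 0 <= 2 * pi :> R by rewrite mulr_ge0 // pi_ge0.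
have := cprim_bound (_ : -1 < 0) pi0 Gg (fun x _ => gM x).
rewrite subr0 => /(_ (ltrN10 R)) /le_trans; apply.
by rewrite le_eqVlt; apply/orP; left; apply/eqP; ring.
Qed.

End Calculus.

(** * Contraction of a circle to an interior point *)

Section CauchyFormula.
Variables (R : realType) (f : Cplx R -> Cplx R) (z : Cplx R) (rho r0 : R).
Hypotheses (z_lt : normc z < rho) (rho_lt : rho < r0).
Hypothesis fd : forall w, normc w < r0 -> exists l, cderiv f w l.

Let rho_gt0 : 0 < rho. Proof. exact: le_lt_trans (normc_ge0 z) z_lt. Qed.

(* [Phi] contracts the circle [zeta] to [z] as [s] goes to -oo. In the coordinates
   (s, t) the form f(w) dw / (w - z) is f(Phi s t) (ds + q t dt). *)
Let zeta t : Cplx R := rho%:C * cis t.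
Let gam t := zeta t - z.
Let q t := 'i * (zeta t / gam t).
Let Phi s t := z + (expR s)%:C * gam t.
(* [f] is only controlled on the disc, where [Phi s t] lies for [s <= 0]. *)
Let P s t := f (Phi (Num.min s 0) t).
Let K := rho / (rho - normc z).

Let K_gt0 : 0 < K. Proof. by rewrite divr_gt0 // subr_gt0. Qed.

Let normc_zeta t : normc (zeta t) = rho.
Proof. by rewrite normcM normc_cis mulr1 normc_real gtr0_norm. Qed.

Let gam_ge t : rho - normc z <= normc (gam t).
Proof.
rewrite lerBlDr -(normc_zeta t) -{1}(subrK z (zeta t)).
exact: ler_normcD.
Qed.

Let gam_neq0 t : gam t != 0.
Proof.
apply/eqP => g0; have := gam_ge t; rewrite g0 normc0 subr_le0.
by rewrite leNgt z_lt.
Qed.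

Let gam_le t : normc (gam t) <= 2 * rho.
Proof.
rewrite (le_trans (ler_normcB _ _)) // normc_zeta mulr2n mulrDl !mul1r.
by rewrite lerD2l ltW.
Qed.

Let normc_i : normc ('i : Cplx R) = 1.
Proof. by rewrite /= expr0n expr1n add0r sqrtr1. Qed.

Let q_le t : normc (q t) <= K.
Proof.
rewrite (normcM 'i) (normcM (zeta t)) normcV normc_i mul1r normc_zeta.
rewrite /K ler_pM2l //.
rewrite lef_pV2 ?posrE ?gam_ge ?subr_gt0 //.
by rewrite (lt_le_trans _ (gam_ge t)) // subr_gt0.
Qed.

Let Phi_le s t : s <= 0 -> normc (Phi s t) <= rho.
Proof.
move=> s0; have e1 : expR s <= 1 by rewrite -expR0 ler_expR.
(* A convex combination, since 0 <= exp s <= 1. *)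
have -> : Phi s t = (1 - expR s)%:C * z + (expR s)%:C * zeta t.
  by rewrite /Phi /gam rmorphB rmorph1; ring.
rewrite (le_trans (ler_normcD _ _)) // (normcM _ z) (normcM _ (zeta t)).
rewrite !normc_real normc_zeta.
rewrite (ger0_norm (expR_ge0 s)) ger0_norm ?subr_ge0 //.
have : 0 <= (1 - expR s) * (rho - normc z).
  by rewrite mulr_ge0 // subr_ge0 // ltW.
lra.
Qed.

Let Phi0 t : Phi 0 t = zeta t.
Proof. by rewrite /Phi expR0 /gam; ring. Qed.

Let cprim_Phi_s c t : cprim c (Phi^~ t) (fun s => (expR s)%:C * gam t).
Proof.
have H := cprimD (@cprim_cst R c z) (cprimZ (gam t) (@cprim_expR R c)).
by apply: cprim_ext H => s; rewrite /Phi; ring.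
Qed.

Let cprim_Phi_t c s : cprim c (Phi s) (fun t => (expR s)%:C * ('i * zeta t)).
Proof.
have H := cprimD (@cprim_cst R c z) (cprimZ (expR s)%:C
  (cprimB (cprimZ rho%:C (@cprim_cis R c)) (@cprim_cst R c z))).
by apply: cprim_ext H => t; rewrite /Phi /gam /zeta; ring.
Qed.

Let ccont_zeta : ccont zeta.
Proof. by apply: ccontM; [exact: ccont_cst|exact: ccont_cis]. Qed.

Let ccont_gam : ccont gam.
Proof. by apply: ccontD => //; exact: ccont_cst. Qed.

Let ccont_q : ccont q.
Proof.
apply: ccontM; first exact: ccont_cst.
by apply: ccontM => //; exact: ccontV.
Qed.

Let P_diff s t : exists l, cderiv f (Phi (Num.min s 0) t) l.
Proof.
apply: fd; apply: le_lt_trans rho_lt; apply: Phi_le.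
by rewrite ge_min lexx orbT.
Qed.

Let ccont_P_t s : ccont (P s).
Proof.
apply: ccont_comp; last by move=> t; exact: P_diff.
apply: ccontD; first exact: ccont_cst.
by apply: ccontM => //; exact: ccont_cst.
Qed.

Let ccont_P_s t : ccont (P^~ t).
Proof.
apply: (@ccont_comp _ f (fun s => Phi (Num.min s 0) t)); last first.
  by move=> s; exact: P_diff.
apply: ccontD; first exact: ccont_cst.
apply: ccontM; last exact: ccont_cst.
split=> x; last exact: cvg_cst.
apply: (@continuous_comp _ _ _ (fun s : R => Num.min s 0) expR); last first.
  exact: continuous_expR.
apply: continuous_min; first exact: cvg_id.
exact: cvg_cst.
Qed.

(** Both partial derivatives of [Phi] have modulus at most 2 rho when s <= 0; the other factor 2 is
    that of [cprim_bound]. *)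
Let Phi_lip s s' t t' : s <= 0 -> s' <= 0 ->
  normc (Phi s' t' - Phi s t) <= 4 * rho * (`|s' - s| + `|t' - t|).
Proof.
move=> s0 s'0.
have Hs a b u : a <= b -> b <= 0 ->
    normc (Phi b u - Phi a u) <= 4 * rho * `|b - a|.
  move=> ab b0; have -> : 4 * rho = 2 * (2 * rho) by ring.
  rewrite (ger0_norm (_ : 0 <= b - a)) ?subr_ge0 //.
  apply: (cprim_bound (_ : a - 1 < a) ab (@cprim_Phi_s (a - 1) u)).
    by rewrite ltrBlDr ltrDl.
  move=> x /andP[_ xb]; rewrite (normcM _ (gam u)) normc_real.
  rewrite (ger0_norm (expR_ge0 x)).
  have e1 : expR x <= 1 by rewrite -expR0 ler_expR (le_trans xb).
  by have := gam_le u; have := expR_gt0 x; have := normc_ge0 (gam u); nra.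
have Ht a b u : u <= 0 -> a <= b ->
    normc (Phi u b - Phi u a) <= 4 * rho * `|b - a|.
  move=> u0 ab; have -> : 4 * rho = 2 * (2 * rho) by ring.
  rewrite (ger0_norm (_ : 0 <= b - a)) ?subr_ge0 //.
  apply: (cprim_bound (_ : a - 1 < a) ab (@cprim_Phi_t (a - 1) u)).
    by rewrite ltrBlDr ltrDl.
  move=> x _; rewrite (normcM _ ('i * _)) (normcM 'i) normc_i mul1r.
  rewrite normc_zeta normc_real (ger0_norm (expR_ge0 u)).
  have e1 : expR u <= 1 by rewrite -expR0 ler_expR.
  have : 0 <= (1 - expR u) * rho by rewrite mulr_ge0 ?subr_ge0 // ltW.
  by have := rho_gt0; lra.
have -> : Phi s' t' - Phi s t = (Phi s' t' - Phi s t') + (Phi s t' - Phi s t).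
  by ring.
rewrite (le_trans (ler_normcD _ _)) // mulrDr lerD //.
  have [ss'|/ltW ss'] := leP s s'; first exact: Hs.
  by rewrite normcB distrC; exact: Hs.
have [tt'|/ltW tt'] := leP t t'; first exact: Ht.
by rewrite normcB distrC; exact: Ht.
Qed.

Let mixed_diff_local (c : R) (A B : R -> R -> Cplx R) (Q : R -> Cplx R) :
  (forall t, cprim c (A^~ t) (P^~ t)) ->
  (forall s, cprim (-1) (B s) (fun t => P s t * q t)) -> cprim (-1) Q q ->
  forall x y, c < x -> x <= 0 -> -1 < y -> forall e, 0 < e ->
  exists2 d, 0 < d & forall s1 s2 t1 t2, c < s1 -> s1 <= x -> x <= s2 ->
    s2 <= 0 -> -1 < t1 -> t1 <= y -> y <= t2 -> s2 - s1 <= d -> t2 - t1 <= d ->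
    normc (mixed_diff (fun s t => B s t - A s t) s1 s2 t1 t2)
      <= e * ((s2 - s1) + (t2 - t1)) ^+ 2.
Proof.
move=> AP BP Qq x y cx x0 y1 e e0.
have [l lP] : exists l, cderiv f (Phi x y) l.
  by apply: fd; apply: le_lt_trans rho_lt; exact: Phi_le.
have r0' := rho_gt0; have K0 := K_gt0.
(* An expansion error eta L sz, with sz the sum of the sides, contributes 4 eta L sz (s2 - s1) over
   the two s-edges and 4 eta L sz K (t2 - t1) over the two t-edges, together at most e sz^2. *)
pose L := 4 * rho; pose eta := e / (4 * L * (1 + K)).
have L0 : 0 < L by rewrite /L; lra.
have eta0 : 0 < eta by rewrite divr_gt0 // !mulr_gt0 //; lra.
have [d d0 dP] := lP _ eta0.
exists (d / (4 * L)); first by rewrite divr_gt0 //; lra.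
move=> s1 s2 t1 t2 cs1 s1x xs2 s20 t1c t1y yt2.
rewrite !ler_pdivlMr; [|lra|lra]; move=> sd td.
pose sz := (s2 - s1) + (t2 - t1).
have sz0 : 0 <= sz by rewrite /sz; lra.
(* The affine expansion at [Phi x y] is recentred at [z] because [Phi s t - z] is the s-derivative
   of [Phi], and its product with [q t] the t-derivative. *)
pose al := f (Phi x y) + l * (z - Phi x y).
have errP s t : s1 <= s <= s2 -> t1 <= t <= t2 ->
    normc (P s t - (al + l * (Phi s t - z))) <= eta * (L * sz).
  move=> /andP[s1s ss2] /andP[t1t tt2]; have s0 := le_trans ss2 s20.
  rewrite /P min_l //; set w := Phi s t; set w0 := Phi x y.
  have hL : normc (w - w0) <= L * sz.
    apply: le_trans (Phi_lip _ _ x0 s0) _; rewrite ler_pM2l // /sz lerD //.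
      by rewrite ler_norml; apply/andP; split; lra.
    by rewrite ler_norml; apply/andP; split; lra.
  have hd : normc (w - w0) < d.
    by apply: le_lt_trans hL _; rewrite /sz; lra.
  have {1}-> : w = w0 + (w - w0) by ring.
  have -> : f (w0 + (w - w0)) - (al + l * (w - z)) =
      f (w0 + (w - w0)) - f w0 - l * (w - w0).
    by rewrite /al -/w0; ring.
  by rewrite (le_trans (dP _ hd)) // ler_pM2l.
(* [al (ds + q dt) + l dPhi] is the exact form obtained by replacing f with its
   first order expansion at [Phi x y]; only the remainder is left to estimate. *)
pose A' s t := A s t - (al * s%:C + l * Phi s t).
pose B' s t := B s t - (al * Q t + l * Phi s t).
have A'P t : t1 <= t <= t2 ->
    normc (A' s2 t - A' s1 t) <= 2 * (eta * (L * sz)) * (s2 - s1).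
  move=> tt; apply: (cprim_bound cs1 (le_trans s1x xs2) (cprimB (AP t)
    (cprimD (cprimZ al (@cprim_id R c)) (cprimZ l (@cprim_Phi_s c t))))) => s ss.
  rewrite mulr1; have -> : (expR s)%:C * gam t = Phi s t - z by rewrite /Phi; ring.
  exact: errP.
have B'P s : s1 <= s <= s2 ->
    normc (B' s t2 - B' s t1) <= 2 * (eta * (L * sz) * K) * (t2 - t1).
  move=> ss; apply: (cprim_bound t1c (le_trans t1y yt2) (cprimB (BP s)
    (cprimD (cprimZ al Qq) (cprimZ l (@cprim_Phi_t (-1) s))))) => t tt.
  have -> : P s t * q t - (al * q t + l * ((expR s)%:C * ('i * zeta t))) =
      (P s t - (al + l * (Phi s t - z))) * q t.
    have -> : 'i * zeta t = gam t * q t.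
      by rewrite /q; field.
    by rewrite /Phi; ring.
  rewrite normcM ler_pM ?normc_ge0 ?q_le //.
  exact: errP.
have -> : mixed_diff (fun s t => B s t - A s t) s1 s2 t1 t2 =
    (B' s2 t2 - B' s2 t1) - (B' s1 t2 - B' s1 t1)
    - ((A' s2 t2 - A' s1 t2) - (A' s2 t1 - A' s1 t1)).
  by rewrite /mixed_diff /A' /B'; ring.
have tt1 : t1 <= t1 <= t2 by rewrite lexx; lra.
have tt2 : t1 <= t2 <= t2 by rewrite lexx andbT; lra.
have ss1 : s1 <= s1 <= s2 by rewrite lexx; lra.
have ss2 : s1 <= s2 <= s2 by rewrite lexx andbT; lra.
apply: le_trans (ler_normcB _ _) _.
apply: le_trans (lerD (ler_normcB _ _) (ler_normcB _ _)) _.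
apply: le_trans (lerD (lerD (B'P _ ss2) (B'P _ ss1))
                      (lerD (A'P _ tt2) (A'P _ tt1))) _.
have -> : e = eta * (4 * L * (1 + K)).
  by rewrite divfK // lt0r_neq0 // !mulr_gt0 //; lra.
rewrite -/sz.
have H0 : 0 <= eta * L * sz by rewrite mulr_ge0 // ltW // mulr_gt0.
have H1 : 0 <= eta * L * sz * K * (s2 - s1).
  by apply: mulr_ge0; [rewrite mulr_ge0 // ltW|lra].
have H2 : 0 <= eta * L * sz * (t2 - t1) by apply: mulr_ge0; [|lra].
rewrite -subr_ge0.
have -> : eta * (4 * L * (1 + K)) * sz ^+ 2 -
   (2 * (eta * (L * sz) * K) * (t2 - t1) + 2 * (eta * (L * sz) * K) * (t2 - t1) +
    (2 * (eta * (L * sz)) * (s2 - s1) + 2 * (eta * (L * sz)) * (s2 - s1))) =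
   4 * (eta * L * sz * K * (s2 - s1)) + 4 * (eta * L * sz * (t2 - t1)).
  by rewrite /sz; ring.
lra.
Qed.

(** The integral around the rectangle [s, 0] x [0, 2 pi] vanishes, and its sides t = 0 and t = 2 pi
    cancel by periodicity of [cis]. *)
Let period_int_const (s : R) (Bs B0 : R -> Cplx R) : s < 0 ->
  cprim (-1) Bs (fun t => P s t * q t) ->
  cprim (-1) B0 (fun t => P 0 t * q t) ->
  Bs (2 * pi) - Bs 0 = B0 (2 * pi) - B0 0.
Proof.
move=> s0 BsP B0P.
have /choice[A AP] : forall t, exists F, cprim (s - 1) F (P^~ t).
  by move=> t; exact: cprim_exists_ccont.
have /choice[B BP] : forall u, exists F, cprim (-1) F (fun t => P u t * q t).
  by move=> u; apply: cprim_exists_ccont; exact: ccontM.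
have [Q' Q'q] := cprim_exists_ccont (-1) ccont_q.
have pi0 : 0 < 2 * pi :> R by rewrite mulr_gt0 // pi_gt0.
have : mixed_diff (fun s t => B s t - A t s) s (s + - s) 0 (0 + 2 * pi) = 0.
  apply: mixed_diff_eq0 => //; first by rewrite oppr_gt0.
  move=> x y /andP[sx]; rewrite subrr add0r => x0 /andP[y0 yp] e e0.
  have [||d d0 dP] := @mixed_diff_local (s - 1) (fun s t => A t s) B Q' AP BP Q'q
    x y _ x0 _ e e0; [lra|lra|].
  exists d => // s1 s2 t1 t2 /andP[ss1 s1x] /andP[xs2 s20] /andP[t10 t1y].
  move=> /andP[yt2 t2p] sd td.
  by apply: dP => //; lra.
rewrite subrr add0r /mixed_diff => H.
have HA : A (2 * pi) 0 - A (2 * pi) s = A 0 0 - A 0 s.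
  apply: (cprim_diff_eq (_ : s - 1 < s) (ltW s0) (AP _) (AP _)) => [|x _].
    by lra.
  by rewrite /P /Phi /gam /zeta cis2pi.
have pi1 := ltW pi0.
have -> : Bs (2 * pi) - Bs 0 = B s (2 * pi) - B s 0.
  by apply: (cprim_diff_eq (_ : -1 < 0) pi1 BsP (BP s)); rewrite ?ltrN10.
have -> : B0 (2 * pi) - B0 0 = B 0 (2 * pi) - B 0 0.
  by apply: (cprim_diff_eq (_ : -1 < 0) pi1 B0P (BP 0)); rewrite ?ltrN10.
apply/eqP; rewrite -subr_eq0 -oppr_eq0; apply/eqP; rewrite -[RHS]H.
have -> : A (2 * pi) 0 = A (2 * pi) s + (A 0 0 - A 0 s) by rewrite -HA; ring.
ring.
Qed.

(** The integral over the contracted circle does not depend on s, and as s tends to -oo continuity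
    of [f] at [z] replaces f by [f z]. The remaining integral is evaluated in [cint_q]. *)
Lemma cauchy_formula : cint (fun t => f (zeta t) * (zeta t / (zeta t - z))) =
  f z * cint (fun t => zeta t / (zeta t - z)).
Proof.
have fzc : ccont (fun t => f (zeta t)).
  apply: ccont_comp => // t; apply: fd.
  by rewrite normc_zeta.
have quoc : ccont (fun t => zeta t / (zeta t - z)).
  by apply: ccontM => //; exact: ccontV.
have i0 : 'i != 0 :> Cplx R.
  apply/eqP => i0; have := normc_i; rewrite i0 normc0 => /eqP.
  by rewrite eq_sym oner_eq0.
apply: (mulfI i0); rewrite mulrCA -(cintZ 'i (ccontM fzc quoc)) -(cintZ 'i quoc).
have -> : (fun t => 'i * (f (zeta t) * (zeta t / (zeta t - z)))) =
    (fun t => P 0 t * q t).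
  by apply/funext => t; rewrite /P minxx Phi0 mulrCA.
have -> : (fun t => 'i * (zeta t / (zeta t - z))) = q by [].
have [B0 B0P] : exists F, cprim (-1) F (fun t => P 0 t * q t).
  by apply: cprim_exists_ccont; exact: ccontM.
have [Q Qq] := cprim_exists_ccont (-1) ccont_q.
rewrite (cintE B0P) (cintE Qq).
apply/eqP; rewrite -subr_eq0; apply/eqP/eq0_normc/eqP.
rewrite eq_le normc_ge0 andbT; apply/ler_addgt0Pr => e e0; rewrite add0r.
have pi0 : 0 < 2 * pi :> R by rewrite mulr_gt0 // pi_gt0.
have [l /cderiv_continuous lP] : exists l, cderiv f z l.
  by apply: fd; exact: lt_trans z_lt rho_lt.
have r0' := rho_gt0; have K0 := K_gt0.
have [e' e'0 eE] : exists2 e', 0 < e' & e = 2 * (e' * K) * (2 * pi - 0).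
  have D0 : 0 < 2 * K * (2 * pi) by apply: mulr_gt0 => //; apply: mulr_gt0.
  exists (e / (2 * K * (2 * pi))); first exact: divr_gt0.
  rewrite -{1}(divfK (lt0r_neq0 D0) e); ring.
have [d d0 dP] := lP _ e'0.
have d4 : 0 < d / (4 * rho) by rewrite divr_gt0 // mulr_gt0.
(* Chosen so that s < 0 and exp s * 2 rho <= d / 2, which puts the contracted circle within [d] of
   [z]. *)
pose s := - 1 - `|ln (d / (4 * rho))|.
have s0 : s < 0 by rewrite /s; have := normr_ge0 (ln (d / (4 * rho))); lra.
have es : expR s <= d / (4 * rho).
  rewrite -[leRHS]lnK ?posrE // ler_expR /s.
  by have := ler_norm (- ln (d / (4 * rho))); rewrite normrN; lra.
have [Bs BsP] : exists F, cprim (-1) F (fun t => P s t * q t).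
  by apply: cprim_exists_ccont; exact: ccontM.
rewrite -(period_int_const s0 BsP B0P).
have -> : Bs (2 * pi) - Bs 0 - f z * (Q (2 * pi) - Q 0) =
  (Bs (2 * pi) - f z * Q (2 * pi)) - (Bs 0 - f z * Q 0) by ring.
rewrite eE.
apply: (cprim_bound (ltrN10 R) (ltW pi0) (cprimB BsP (cprimZ (f z) Qq))) => t _.
have -> : P s t * q t - f z * q t = (P s t - f z) * q t by ring.
rewrite normcM ler_pM ?normc_ge0 ?q_le // /P min_l ?(ltW s0) // /Phi.
apply: dP; rewrite (normcM _ (gam t)) normc_real (ger0_norm (expR_ge0 s)).
have := gam_le t; have := normc_ge0 (gam t); have := expR_gt0 s.
move: es; rewrite ler_pdivlMr ?mulr_gt0 // => es p1 p2 p3.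
have : expR s * normc (gam t) <= expR s * (2 * rho) by rewrite ler_pM2l.
lra.
Qed.
End CauchyFormula.

(** * Taylor jets and Cauchy's estimates *)

Section TaylorJet.
Variable R : realType.

Lemma cprimM c (F g G h : R -> Cplx R) : cprim c F g -> cprim c G h ->
  cprim c (fun t => F t * G t) (fun t => F t * h t + g t * G t).
Proof.
move=> Fg Gh x cx; have [FR FI] := Fg x cx; have [GR GI] := Gh x cx.
split; rewrite raddfD /= ?cReM ?cImM.
  under [X in is_derive _ _ X _]eq_fun do rewrite cReM.
  by apply: is_derive_eq; rewrite /GRing.scale /=; ring.
under [X in is_derive _ _ X _]eq_fun do rewrite cImM.
by apply: is_derive_eq; rewrite /GRing.scale /=; ring.
Qed.

Lemma cReN (x : Cplx R) : Re (- x) = - Re x.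
Proof. by case: x. Qed.

Lemma cImN (x : Cplx R) : Im (- x) = - Im x.
Proof. by case: x. Qed.

Lemma cisV t : (cis t : Cplx R)^-1 = cos t -i* sin t.
Proof. by rewrite /cis /GRing.inv /= cos2Dsin2 !divr1. Qed.

Lemma cprim_cisV c : @cprim R c (fun t => (cis t)^-1) (fun t => - 'i * (cis t)^-1).
Proof.
move=> x _; split.
  under [X in is_derive _ _ X _]eq_fun do rewrite cisV /=.
  by rewrite mulNr cReN cReM cisV /=; apply: is_derive_eq; ring.
under [X in is_derive _ _ X _]eq_fun do rewrite cisV /=.
by rewrite mulNr cImN cImM cisV /=; apply: is_derive_eq; ring.
Qed.

Lemma cprim_cisVX c k : @cprim R c (fun t => (cis t)^-1 ^+ k)
  (fun t => - 'i * k%:R * (cis t)^-1 ^+ k).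
Proof.
elim: k => [|k IH].
  apply: cprim_ext (@cprim_cst R c 1) => // t.
  by rewrite mulr0 mul0r.
apply: cprim_ext (cprimM (@cprim_cisV c) IH) => t; first by rewrite exprS.
by rewrite exprS; ring.
Qed.

Lemma cint_cst (k : Cplx R) : cint (fun=> k) = k * (2 * pi)%:C.
Proof.
have H : cprim (-1) (fun t : R => k * t%:C) (fun=> k).
  by apply: cprim_ext (cprimZ k (@cprim_id R (-1))) => // t; rewrite mulr1.
by rewrite (cintE H) -mulrBr subr0.
Qed.

Lemma cint_cisVX k : (0 < k)%N -> cint (fun t : R => (cis t)^-1 ^+ k) = 0.
Proof.
move=> k0; have k1 : (k%:R : Cplx R) != 0 by rewrite pnatr_eq0 -lt0n.
have i2 : 'i * 'i = -1 :> Cplx R by rewrite -expr2 sqr_i.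
have H : cprim (-1) (fun t : R => 'i / k%:R * (cis t)^-1 ^+ k)
    (fun t => (cis t)^-1 ^+ k).
  apply: cprim_ext (cprimZ ('i / k%:R) (@cprim_cisVX (-1) k)) => // t.
  have -> : 'i / k%:R * (- 'i * k%:R * (cis t)^-1 ^+ k) =
    - ('i * 'i) * (k%:R / k%:R) * (cis t)^-1 ^+ k by ring.
  by rewrite i2 opprK divff // !mul1r.
by rewrite (cintE H) cis2pi subrr.
Qed.

Variables (rho : R) (z : Cplx R).
Hypothesis z_lt : 2 * normc z < rho.

Let zeta t : Cplx R := rho%:C * cis t.
Let q t := zeta t / (zeta t - z).

Let rho_gt0 : 0 < rho.
Proof. by apply: le_lt_trans z_lt; rewrite mulr_ge0 ?normc_ge0. Qed.

Let rhoC : rho%:C != 0 :> Cplx R.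
Proof. by apply/eqP => -[] /eqP; rewrite gt_eqF. Qed.

Let cis_neq0 t : cis t != 0 :> Cplx R.
Proof.
apply/eqP => c0; have := normc_cis t; rewrite c0 normc0 => /eqP.
by rewrite eq_sym oner_eq0.
Qed.

Let normc_zeta t : normc (zeta t) = rho.
Proof. by rewrite normcM normc_cis mulr1 normc_real gtr0_norm. Qed.

Let zeta_neq0 t : zeta t != 0. Proof. by rewrite mulf_neq0. Qed.

Let gam_ge t : rho / 2 <= normc (zeta t - z).
Proof.
have := ler_normcD (zeta t - z) z; rewrite subrK normc_zeta => H.
have := z_lt; lra.
Qed.

Let gam_neq0 t : zeta t - z != 0.
Proof.
apply/eqP => g0; have := gam_ge t; rewrite g0 normc0.
by have := rho_gt0; lra.
Qed.

Let ccont_zeta : ccont zeta.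
Proof. by apply: ccontM; [exact: ccont_cst|exact: ccont_cis]. Qed.

Let ccont_q : ccont q.
Proof.
apply: ccontM => //; apply: ccontV => //.
by apply: ccontD => //; exact: ccont_cst.
Qed.

Let ccont_u : ccont (fun t => (zeta t)^-1).
Proof. exact: ccontV. Qed.

Let q_le t : normc (q t) <= 2.
Proof.
rewrite normcM normcV normc_zeta ler_pdivrMr; first by have := gam_ge t; lra.
by apply: lt_le_trans (gam_ge t); rewrite divr_gt0.
Qed.

(** A finite geometric series with exact remainder, obtained by iterating q = 1 + z q / zeta under
    the integral. *)
Lemma geometric_cint F N : ccont F ->
  cint (fun t => F t * q t) =
  \sum_(k < N) cint (fun t => F t * (zeta t)^-1 ^+ k) * z ^+ k +
  z ^+ N * cint (fun t => F t * (zeta t)^-1 ^+ N * q t).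
Proof.
move=> Fc; elim: N => [|N IH].
  by rewrite big_ord0 add0r mul1r; congr cint; apply/funext => t; rewrite mulr1.
have FuN : ccont (fun t => F t * (zeta t)^-1 ^+ N).
  by apply: ccontM => //; exact: ccontX.
have FuN1 : ccont (fun t => F t * (zeta t)^-1 ^+ N.+1 * q t).
  by apply: ccontM => //; apply: ccontM => //; exact: ccontX.
rewrite IH big_ord_recr /= -addrA; congr (_ + _).
have -> : (fun t => F t * (zeta t)^-1 ^+ N * q t) =
    (fun t => F t * (zeta t)^-1 ^+ N + z * (F t * (zeta t)^-1 ^+ N.+1 * q t)).
  apply/funext => t; rewrite exprS.
  have {1}-> : q t = 1 + z * ((zeta t)^-1 * q t).
    by rewrite /q; field; rewrite zeta_neq0 gam_neq0.
  ring.
rewrite cintD //; last by apply: ccontM => //; exact: ccont_cst.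
by rewrite cintZ // mulrDr exprS; ring.
Qed.

Lemma geometric_remainder_bound F M N : ccont F ->
  (forall t, normc (F t) <= M) ->
  normc (cint (fun t => F t * (zeta t)^-1 ^+ N * q t)) <=
    8 * pi * M / rho ^+ N.
Proof.
move=> Fc FM.
have -> : 8 * pi * M / rho ^+ N = 4 * pi * (M / rho ^+ N * 2) by ring.
apply: cint_bound => [|t].
  by apply: ccontM => //; apply: ccontM => //; exact: ccontX.
rewrite (normcM _ (q t)) ler_pM ?normc_ge0 ?q_le //.
rewrite (normcM (F t)) normcX normcV normc_zeta exprVn.
by rewrite ler_wpM2r // invr_ge0 exprn_ge0 // ltW.
Qed.

(** In the geometric series for F = 1 only the term k = 0 survives, negative powers of [cis] having
    periodic primitives. The remainder is at most 8 pi / 2^(N+1) because 2 |z| < rho. *)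
Lemma cint_q : cint q = (2 * pi)%:C.
Proof.
have c1 : ccont (fun _ : R => 1 : Cplx R) by exact: ccont_cst.
apply/eqP; rewrite -subr_eq0; apply/eqP/eq0_normc/eqP.
rewrite eq_le normc_ge0 andbT; apply/ler_addgt0Pr => e e0; rewrite add0r.
have pi0 : 0 < pi :> R := pi_gt0 R.
have [N NP] := exists_expn2_ge (8 * pi / e).
have := geometric_cint N.+1 c1.
under eq_fun do rewrite mul1r; move=> ->.
rewrite big_ord_recl big1 => [|k _]; last first.
  have -> : (fun t => 1 * (zeta t)^-1 ^+ lift ord0 k) =
      (fun t => rho%:C^-1 ^+ lift ord0 k * (cis t)^-1 ^+ lift ord0 k).
    by apply/funext => t; rewrite mul1r invfM exprMn.
  rewrite cintZ; last by apply/ccontX/ccontV => //; exact: ccont_cis.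
  by rewrite cint_cisVX // mulr0 mul0r.
have -> : (fun t => 1 * (zeta t)^-1 ^+ (ord0 : 'I_N.+1)) = (fun=> 1).
  by apply/funext => t; rewrite mul1r.
rewrite cint_cst !mul1r mulr1 addr0 addrC addKr.
rewrite normcM normcX.
have /le_trans -> // : normc z ^+ N.+1 *
    normc (cint (fun t => 1 * (zeta t)^-1 ^+ N.+1 * q t)) <=
    (rho / 2) ^+ N.+1 * (8 * pi * 1 / rho ^+ N.+1).
  apply: ler_pM; rewrite ?exprn_ge0 ?normc_ge0 //.
    by rewrite lerXn2r ?nnegrE ?normc_ge0 //; have := z_lt; have := rho_gt0; lra.
  by apply: geometric_remainder_bound => // t; rewrite normc1.
have -> : (rho / 2) ^+ N.+1 * (8 * pi * 1 / rho ^+ N.+1) = 8 * pi / 2 ^+ N.+1.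
  by rewrite expr_div_n; field; rewrite !expf_neq0 // ?lt0r_neq0.
rewrite ler_pdivrMr ?exprn_gt0 // exprS mulrCA.
move: NP; rewrite ler_pdivrMr // => NP.
have e2N : 0 < e * 2 ^+ N by rewrite mulr_gt0 // exprn_gt0.
by rewrite [e * _]mulrC in e2N *; lra.
Qed.

End TaylorJet.

(** The coefficients are Cauchy integrals over the circle of radius [rho], and the error is the
    remainder of [geometric_cint]. In the last bound one factor 2 comes from [cprim_bound], the
    other from |zeta / (zeta - z)| <= 2. *)
Theorem taylor_jet (R : realType) (f : Cplx R -> Cplx R) (r0 rho M : R) N :
  0 < rho -> rho < r0 ->
  (forall w, normc w < r0 -> exists l, cderiv f w l) ->
  (forall w, normc w <= rho -> normc (f w) <= M) ->
  exists p : {poly Cplx R}, [/\ (size p <= N)%N,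
    forall i, normc p`_i <= 2 * M / rho ^+ i &
    forall z, 2 * normc z < rho ->
      normc (f z - p.[z]) <= 4 * M / rho ^+ N * normc z ^+ N].
Proof.
move=> rho0 rho_lt fd fM.
have pi0 : 0 < pi :> R := pi_gt0 R.
have pC : (2 * pi)%:C != 0 :> Cplx R.
  by apply/eqP => -[] /eqP; rewrite gt_eqF // mulr_gt0.
pose F t := f (rho%:C * cis t).
have normc_zeta t : normc (rho%:C * cis t : Cplx R) = rho.
  by rewrite normcM normc_cis mulr1 normc_real gtr0_norm.
have zc : ccont (fun t => rho%:C * cis t : Cplx R).
  by apply: ccontM; [exact: ccont_cst|exact: ccont_cis].
have Fc : ccont F.
  by apply: ccont_comp => // t; apply: fd; rewrite normc_zeta.
have FM t : normc (F t) <= M by rewrite fM ?normc_zeta.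
have M0 : 0 <= M := le_trans (normc_ge0 _) (FM 0).
pose a k := cint (fun t => F t * (rho%:C * cis t)^-1 ^+ k) / (2 * pi)%:C.
have normpC : normc ((2 * pi)%:C : Cplx R) = 2 * pi.
  by rewrite normc_real gtr0_norm // mulr_gt0.
exists (\poly_(k < N) a k); split; first exact: size_poly.
  move=> i; rewrite coef_poly; case: ifP => _; last first.
    by rewrite normc0 divr_ge0 ?mulr_ge0 ?exprn_ge0 // ltW.
  rewrite /a normcM normcV normpC ler_pdivrMr ?mulr_gt0 //.
  have -> : 2 * M / rho ^+ i * (2 * pi) = 4 * pi * (M / rho ^+ i) by ring.
  apply: cint_bound => [|t].
    apply: ccontM => //; apply/ccontX/ccontV => // t.
    by apply/eqP => z0; move: (normc_zeta t); rewrite z0 normc0 => /eqP; rewrite lt_eqF.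
  rewrite (normcM (F t)) normcX normcV normc_zeta exprVn.
  by rewrite ler_wpM2r // invr_ge0 exprn_ge0 // ltW.
move=> z z_lt.
have z_lt' : normc z < rho by have := normc_ge0 z; lra.
have := cauchy_formula z_lt' rho_lt fd.
rewrite (geometric_cint z_lt N Fc) (cint_q z_lt) => E.
have -> : f z - (\poly_(k < N) a k).[z] = z ^+ N * cint (fun t => F t *
    (rho%:C * cis t)^-1 ^+ N * (rho%:C * cis t / (rho%:C * cis t - z))) / (2 * pi)%:C.
  apply: (mulIf pC); rewrite mulrBl -E divfK // horner_poly mulr_suml.
  under [X in _ - X]eq_bigr => k _ do rewrite mulrAC divfK //.
  by rewrite addrC addKr.
rewrite normcM normcV normpC ler_pdivrMr ?mulr_gt0 // normcM normcX mulrC.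
have -> : 4 * M / rho ^+ N * normc z ^+ N * (2 * pi) =
  8 * pi * M / rho ^+ N * normc z ^+ N by ring.
rewrite ler_wpM2r ?exprn_ge0 ?normc_ge0 //.
exact: geometric_remainder_bound.
Qed.

(** * Jets of holomorphic matrices *)

Section MatrixDerivative.
Variable K : numFieldType.

Lemma derive_cvgP (V : normedModType K) (f : K -> V) (z : K) (l : V) :
  is_derive z 1 f l <-> h^-1 *: (f (h + z) - f z) @[h --> 0^'] --> l.
Proof.
have E : (fun h : K => h^-1 *: ((f \o shift z) (h *: 1) - f z)) =
    (fun h => h^-1 *: (f (h + z) - f z)).
  by apply/funext => h; rewrite /= /GRing.scale /= mulr1.
split=> [[df <-]|fl]; first by rewrite -E; exact: df.
have fl' : h^-1 *: ((f \o shift z) (h *: 1) - f z) @[h --> 0^'] --> l by rewrite E.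
by apply: DeriveDef; [exact: cvgP fl'|exact: cvg_lim fl'].
Qed.

Lemma cvg_mxP (T : Type) (F : set_system T) (FF : Filter F) m n
    (f : T -> 'M[K]_(m, n)) (l : 'M[K]_(m, n)) :
  f @ F --> l <-> forall i j, (fun t => f t i j) @ F --> l i j.
Proof.
split=> [fl i j|fl].
  apply: (@cvg_comp _ _ _ f (fun M : 'M[K]_(m, n) => M i j) _ _ _ fl).
  exact: coord_continuous.
apply/cvg_ballP => e e0.
have H : \forall t \near F, forall i j, ball (l i j) e (f t i j).
  apply: filter_forall => i; apply: filter_forall => j.
  by have /cvg_ballP := fl i j; apply.
by apply: filterS H => t; split.
Qed.

Lemma is_derive_mxP m n (f : K -> 'M[K]_(m, n)) (z : K) (l : 'M[K]_(m, n)) :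
  is_derive z 1 f l <-> forall i j, is_derive z 1 (fun t => f t i j) (l i j).
Proof.
split=> [/derive_cvgP/cvg_mxP fl i j|fl].
  apply/derive_cvgP; have := fl i j.
  by under eq_fun do rewrite !mxE.
apply/derive_cvgP/cvg_mxP => i j; have /derive_cvgP := fl i j.
by under [X in _ -> X @ _ --> _]eq_fun do rewrite !mxE.
Qed.

Lemma is_derive_horner (p : {poly K}) (z : K) : is_derive z 1 (horner p) p^`().[z].
Proof.
elim/poly_ind: p => [|p c IH].
  have -> : horner (0 : {poly K}) = cst 0 by apply/funext => x; rewrite horner0.
  by rewrite deriv0 horner0; exact: is_derive_cst.
have -> : horner (p * 'X + c%:P) = horner p * id + cst c.
  by apply/funext => x; rewrite hornerMXaddC.
have := is_deriveD (is_deriveM IH (is_derive_id z 1)) (is_derive_cst c z 1).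
rewrite addr0 derivMXaddC hornerD hornerM hornerX /GRing.scale /= mulr1.
by rewrite [z * _]mulrC.
Qed.

End MatrixDerivative.

(** * Derivatives in terms of the modulus, and limits along ultrafilters *)

Section UltrafilterLimits.
Variable R : realType.

Lemma is_derive_cderiv (f : Cplx R -> Cplx R) (z l : Cplx R) :
  is_derive z 1 f l -> cderiv f z l.
Proof.
move=> /derive_cvgP/cvgrPdist_le fl e e0.
have /fl : 0 < (e%:C : Cplx R) by rewrite ltcR.
move=> /nbhs_ballP[d /= d0 dP].
(* The radius of a ball is an element of [Cplx R]; being positive, it is real. *)
have [dr dE] : exists r : R, d = r%:C.
  by apply/complex_realP; rewrite realE ltW.
exists dr; first by rewrite -ltcR -dE.
move=> h hd; have [->|h0] := eqVneq h 0.
  by rewrite addr0 mulr0 subrr subrr normc0 mulr0.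
have : `|l - h^-1 *: (f (h + z) - f z)| <= e%:C.
  apply: dP => //; rewrite -ball_normE /ball_ /= sub0r normrN dE normE ltcR.
  exact: hd.
rewrite normE lecR => H.
have -> : f (z + h) - f z - l * h = - ((l - h^-1 *: (f (h + z) - f z)) * h).
  rewrite mulrBl /GRing.scale /= mulrAC mulVf // mul1r opprB addrC [h + z]addrC.
  by rewrite addrC.
rewrite normcN normcM ler_wpM2r ?normc_ge0 //.
Qed.

Lemma cderiv_uniq (f : Cplx R -> Cplx R) z l l' :
  cderiv f z l -> cderiv f z l' -> l = l'.
Proof.
move=> fl fl'; apply/eqP; rewrite -subr_eq0; apply/eqP/eq0_normc/eqP.
rewrite eq_le normc_ge0 andbT; apply/ler_addgt0Pr => e e0; rewrite add0r.
have e2 : 0 < e / 2 by rewrite divr_gt0.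
have [d d0 dP] := fl _ e2; have [d' d'0 d'P] := fl' _ e2.
pose m := Num.min d d' / 2.
have m0 : 0 < m by rewrite divr_gt0 // lt_min d0.
have mn : normc (m%:C : Cplx R) = m by rewrite normc_real gtr0_norm.
have md : m < Num.min d d' by rewrite /m ltr_pdivrMr // mulr_natr mulr2n ltrDl lt_min d0.
move: md; rewrite lt_min => /andP[md md'].
have := dP m%:C; have := d'P m%:C; rewrite mn => /(_ md') H' /(_ md) H.
rewrite -(ler_pM2r m0) -{1}mn -normcM.
have -> : (l - l') * m%:C = (f (z + m%:C) - f z - l' * m%:C) -
   (f (z + m%:C) - f z - l * m%:C) by ring.
by rewrite (le_trans (ler_normcB _ _)) // (splitr e) mulrDl lerD.
Qed.

(** The limit is the supremum of the x with x <= u j for [G]-almost all j. Beyond it the ultrafilter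
    contains the complementary set, which gives the upper bound. *)
Lemma ultra_cvg_bounded (G : set_system nat) (GU : UltraFilter G) (u : nat -> R)
    (M : R) : (forall j, `|u j| <= M) ->
  exists l, forall e, 0 < e -> G [set j | `|l - u j| <= e].
Proof.
move=> uM; have GP := @ultra_proper _ _ GU.
pose S := [set x | G [set j | x <= u j]].
have GT (P : nat -> Prop) : (forall j, P j) -> G [set j | P j].
  by move=> PT; apply: filterS filterT => j _; exact: PT.
have S_sup : has_sup S.
  split.
    by exists (- M); apply: GT => j; have := uM j; rewrite ler_norml => /andP[].
  exists M => x Sx; have [j /= xu] := filter_ex Sx.
  by rewrite (le_trans xu) // (le_trans (ler_norm _)).
exists (sup S) => e e0.
have [x Sx xl] := sup_adherent e0 S_sup.
have nS : ~ S (sup S + e).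
  move=> /(ub_le_sup (proj2 S_sup)).
  by apply/negP; rewrite -ltNge ltrDl.
have [//|G1] := in_ultra_setVsetC [set j | sup S + e <= u j] GU.
apply: filterS (filterI Sx G1) => j /= [xu /negP]; rewrite -ltNge => uS.
by rewrite ler_norml; apply/andP; split; lra.
Qed.

Lemma ultra_cvg_complex (G : set_system nat) (GU : UltraFilter G)
    (u : nat -> Cplx R) (M : R) : (forall j, normc (u j) <= M) ->
  exists l : Cplx R, u @ G --> l.
Proof.
move=> uM; have GP := @ultra_proper _ _ GU.
have [|a aP] := @ultra_cvg_bounded G GU (fun j => Re (u j)) M.
  by move=> j; exact: le_trans (normc_Re _) (uM j).
have [|b bP] := @ultra_cvg_bounded G GU (fun j => Im (u j)) M.
  by move=> j; exact: le_trans (normc_Im _) (uM j).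
exists (a +i* b); apply/cvgrPdist_le => e e0.
have [er eE] : exists r : R, e = r%:C.
  by apply/complex_realP; rewrite realE ltW.
have er0 : 0 < er / 2 by rewrite divr_gt0 // -ltcR -eE.
apply: filterS (filterI (aP _ er0) (bP _ er0)) => j [/= aj bj].
rewrite eE normE lecR (le_trans (normc_leD _)) // (splitr er) !raddfB.
exact: lerD.
Qed.

End UltrafilterLimits.

(** * Jets of characteristic polynomials *)

Section Jets.
Variable R : realType.
Implicit Types (p : {poly Cplx R}) (z : Cplx R).

Lemma horner_continuous_at p z (e : R) : 0 < e ->
  exists2 d : R, 0 < d & forall h, normc h < d -> normc (p.[z + h] - p.[z]) <= e.
Proof. exact: cderiv_continuous (is_derive_cderiv (is_derive_horner p z)) e. Qed.

(** Continuity gives p(0) = 0; writing p = X q, the bound divided by |z| passes to q away from 0,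
    and induction applies. *)
Lemma dvdXn_of_small p N (K d : R) : 0 < d ->
  (forall z, z != 0 -> normc z < d -> normc p.[z] <= K * normc z ^+ N) ->
  'X^N %| p.
Proof.
move=> d0; elim: N p => [|N IH] p pK; first by rewrite expr0 dvd1p.
have p0 : p.[0] = 0.
  apply/eq0_normc/eqP; rewrite eq_le normc_ge0 andbT.
  apply/ler_addgt0Pr => e e0; rewrite add0r.
  have e2 : 0 < e / 2 by rewrite divr_gt0.
  have [d' d'0 d'P] := horner_continuous_at p 0 e2.
  have K0 : 0 < `|K| + 1 by rewrite ltr_wpDl.
  (* A real test point: m < 1 gives m^N <= 1, and the last entry then gives K m^(N+1) <= e / 2. *)
  pose m := Num.min (Num.min d d') (Num.min 1 (e / 2 / (`|K| + 1))) / 2.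
  have M0 : 0 < Num.min (Num.min d d') (Num.min 1 (e / 2 / (`|K| + 1))).
    by rewrite !lt_min d0 d'0 ltr01 divr_gt0.
  have m0 : 0 < m by rewrite divr_gt0.
  have : m < Num.min (Num.min d d') (Num.min 1 (e / 2 / (`|K| + 1))).
    by rewrite /m ltr_pdivrMr // mulr_natr mulr2n ltrDl.
  rewrite !lt_min ltr_pdivlMr // => /andP[/andP[md md'] /andP[m1 mK]].
  have mn : normc (m%:C : Cplx R) = m by rewrite normc_real gtr0_norm.
  have m_neq0 : m%:C != 0 :> Cplx R by apply/eqP => -[] /eqP; rewrite gt_eqF.
  have := pK m%:C; have := d'P m%:C; rewrite mn add0r => /(_ md') H1 /(_ m_neq0 md) H2.
  have H3 : K * m ^+ N.+1 <= e / 2.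
    apply: le_trans (ltW mK); rewrite exprS mulrCA ler_pM2l //.
    have [K0'|/ltW K0'] := leP 0 K.
      have mN : m ^+ N <= 1 by rewrite exprn_ile1 // ltW.
      by rewrite (le_trans (ler_piMr K0' mN)) // (le_trans (ler_norm K)) // lerDl.
    by rewrite (le_trans (mulr_le0_ge0 K0' _)) ?exprn_ge0 // ltW.
  have -> : p.[0] = p.[m%:C] - (p.[m%:C] - p.[0]) by ring.
  by rewrite (le_trans (ler_normcB _ _)) // (splitr e) lerD // (le_trans H2).
have /dvdpP[q qE] : 'X %| p.
  by have := dvdp_XsubCl p 0; rewrite subr0 => ->; apply/eqP.
rewrite qE exprSr dvdp_mul2r ?polyX_eq0 //; apply: IH => z z0 zd.
have := pK z z0 zd; rewrite qE hornerM hornerX normcM exprSr mulrA ler_pM2r //.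
by rewrite lt_neqAle normc_ge0 andbT eq_sym; apply: contra z0 => /eqP/eq0_normc ->.
Qed.

Lemma char_coef_derivable n (phi : Cplx R -> 'M[Cplx R]_n) z k :
  derivable phi z 1 -> derivable (fun w => (char_poly (phi w))`_k) z 1.
Proof.
move=> dphi; move: k; apply: (@char_poly_closed (Cplx R) (Cplx R)
  (fun f : Cplx R -> Cplx R => derivable f z 1)).
- by move=> c; exact: derivable_cst.
- by move=> f g df dg; exact: derivableD.
- move=> f g df dg.
  have H := derivableM df dg.
  exact: H.
- by move=> f g /funext ->.
have /is_derive_mxP H : is_derive z 1 phi ('D_1 phi z) by exact: DeriveDef.
by move=> i j; have [] := H i j.
Qed.

(** The degree of [p] is free: [p] is determined only modulo X^N, see [jet_uniq]. *)
Definition jet N (f : Cplx R -> Cplx R) p := exists K d : R, 0 < d /\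
  forall z, normc z < d -> normc (f z - p.[z]) <= K * normc z ^+ N.

Lemma char_coef_jet n N (phi : Cplx R -> 'M[Cplx R]_n)
    (P : 'M[{poly Cplx R}]_n) :
  (forall i j, jet N (fun z => phi z i j) (P i j)) ->
  forall k, jet N (fun z => (char_poly (phi z))`_k) (char_poly P)`_k.
Proof.
move=> phiP k.
pose M (t : bool * Cplx R) := if t.1 then phi t.2 else map_mx (horner_eval t.2) P.
(* The boolean selects the map or its jet. Local boundedness is part of [S] because the error of a
   product involves the factors themselves. *)
pose S (u : bool * Cplx R -> Cplx R) := exists K d : R, 0 < d /\
  forall z, normc z < d ->
    [/\ normc (u (true, z) - u (false, z)) <= K * normc z ^+ N,
        normc (u (true, z)) <= K & normc (u (false, z)) <= K].
suff : S (fun t => (char_poly (M t))`_k).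
  move=> [K [d [d0 KP]]]; exists K, d; split => // z /KP[+ _ _].
  by rewrite /M /= -map_char_poly coef_map.
move: k; apply: char_poly_closed.
- move=> c; exists (normc c), 1; split => // z _; rewrite subrr normc0.
  by rewrite mulr_ge0 ?exprn_ge0 ?normc_ge0.
- move=> f g [Kf [df [df0 fP]]] [Kg [dg [dg0 gP]]].
  exists (Kf + Kg), (Num.min df dg); split; first by rewrite lt_min df0.
  move=> z; rewrite lt_min => /andP[/fP[f1 f2 f3] /gP[g1 g2 g3]].
  split; [|by rewrite (le_trans (ler_normcD _ _)) // lerD|
    by rewrite (le_trans (ler_normcD _ _)) // lerD].
  rewrite opprD addrACA (le_trans (ler_normcD _ _)) // mulrDl.
  exact: lerD.
- move=> f g [Kf [df [df0 fP]]] [Kg [dg [dg0 gP]]].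
  exists (Kf * Kg + Kf * Kg), (Num.min df dg); split; first by rewrite lt_min df0.
  move=> z; rewrite lt_min => /andP[/fP[f1 f2 f3] /gP[g1 g2 g3]].
  have Kf0 := le_trans (normc_ge0 _) f2; have Kg0 := le_trans (normc_ge0 _) g2.
  have KK : 0 <= Kf * Kg by exact: mulr_ge0.
  split; [|by rewrite normcM (le_trans (ler_pM _ _ f2 g2)) ?normc_ge0 // lerDl
    |by rewrite normcM (le_trans (ler_pM _ _ f3 g3)) ?normc_ge0 // lerDl].
  have -> : f (true, z) * g (true, z) - f (false, z) * g (false, z) =
    (f (true, z) - f (false, z)) * g (true, z) +
    f (false, z) * (g (true, z) - g (false, z)) by ring.
  rewrite (le_trans (ler_normcD _ _)) // !normcM mulrDl lerD //.
    by rewrite mulrAC ler_pM ?normc_ge0.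
  by rewrite -mulrA ler_pM ?normc_ge0.
- by move=> f g /funext ->.
move=> i j; have [K [d [d0 KP]]] := phiP i j.
have [d' d'0 d'P] := horner_continuous_at (P i j) 0 ltr01.
exists (`|K| + (1 + normc (P i j).[0])), (Num.min 1 (Num.min d d')).
split; first by rewrite !lt_min ltr01 d0.
move=> z; rewrite !lt_min => /andP[z1 /andP[zd zd']].
have H3 : normc (P i j).[z] <= 1 + normc (P i j).[0].
  have -> : (P i j).[z] = ((P i j).[0 + z] - (P i j).[0]) + (P i j).[0].
    by rewrite add0r subrK.
  by rewrite (le_trans (ler_normcD _ _)) // lerD2r d'P.
have z0 : 0 <= normc z ^+ N by rewrite exprn_ge0 ?normc_ge0.
have H1 : normc (phi z i j - (P i j).[z]) <= `|K| * normc z ^+ N.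
  by rewrite (le_trans (KP _ zd)) // ler_wpM2r // ler_norm.
have zN : normc z ^+ N <= 1 by rewrite exprn_ile1 ?normc_ge0 // ltW.
have H0 := le_trans (normc_ge0 _) H3.
rewrite /M /= mxE /horner_eval; split.
- by rewrite (le_trans H1) // ler_wpM2r // lerDl.
- have -> : phi z i j = (phi z i j - (P i j).[z]) + (P i j).[z] by ring.
  rewrite (le_trans (ler_normcD _ _)) // lerD // (le_trans H1) //.
  by rewrite ler_piMr.
by rewrite (le_trans H3) // lerDr.
Qed.

Lemma cvg_sum_seq (T I : Type) (G : set_system T) (FG : Filter G) (r : seq I)
    (f : I -> T -> Cplx R) (l : I -> Cplx R) : (forall i, f i @ G --> l i) ->
  (fun t => \sum_(i <- r) f i t) @ G --> \sum_(i <- r) l i.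
Proof.
move=> fl; elim: r => [|i r IH].
  by under eq_fun do rewrite big_nil; rewrite big_nil; exact: cvg_cst.
under eq_fun do rewrite big_cons; rewrite big_cons.
have H := cvgD (fl i) IH.
exact: H.
Qed.

Lemma char_coef_cvg n (G : set_system nat) (GP : ProperFilter G)
    (P_ : nat -> 'M[{poly Cplx R}]_n) (P : 'M[{poly Cplx R}]_n) :
  (forall i j l, (fun m => (P_ m i j)`_l : Cplx R) @ G --> ((P i j)`_l : Cplx R)) ->
  forall k l, (fun m => ((char_poly (P_ m))`_k)`_l : Cplx R) @ G -->
    (((char_poly P)`_k)`_l : Cplx R).
Proof.
move=> cP k.
(* [None] is the index of the limit, so that convergence is a property of one function. *)
pose M (t : option nat) := if t is Some m then P_ m else P.
pose S (u : option nat -> {poly Cplx R}) := forall l,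
  (fun m => (u (Some m))`_l : Cplx R) @ G --> ((u None)`_l : Cplx R).
suff : S (fun t => (char_poly (M t))`_k) by [].
move: k; apply: char_poly_closed.
- by move=> c l; exact: cvg_cst.
- move=> f g Sf Sg l; under eq_fun do rewrite coefD; rewrite coefD.
  have H := cvgD (Sf l) (Sg l).
  exact: H.
- move=> f g Sf Sg l; under eq_fun do rewrite coefM; rewrite coefM.
  apply: cvg_sum_seq => i.
  have H := cvgM (Sf i) (Sg (l - i)%N).
  exact: H.
- by move=> f g /funext ->.
exact: cP.
Qed.

(** Multiplying by X - a with |a| <= 1 at most doubles a bound on the coefficients. *)
Lemma coef_prod_XsubC_bound (s : seq (Cplx R)) k :
  (forall a, a \in s -> normc a <= 1) ->
  normc (\prod_(a <- s) ('X - a%:P))`_k <= 2 ^+ size s.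
Proof.
elim: s k => [|a s IH] k s1.
  rewrite big_nil coef1 expr0; case: (k == 0)%N; first by rewrite normc1.
  by rewrite normc0.
have {}IH i : normc (\prod_(b <- s) ('X - b%:P))`_i <= 2 ^+ size s.
  by apply: IH => b bs; rewrite s1 // inE bs orbT.
rewrite big_cons mulrBl coefB coefXM coefCM /= exprS mulr2n mulrDl !mul1r.
rewrite (le_trans (ler_normcB _ _)) // lerD //.
  case: k => [|k]; last exact: IH.
  by rewrite eqxx normc0 exprn_ge0.
rewrite normcM (le_trans (ler_pM _ _ (s1 a _) (IH k))) ?normc_ge0 ?mul1r //.
exact: mem_head.
Qed.

Lemma char_poly_roots n (A : 'M[Cplx R]_n) : exists s : seq (Cplx R),
  [/\ char_poly A = \prod_(a <- s) ('X - a%:P), size s = n &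
      forall a, spectrum A a <-> a \in s].
Proof.
have [s] := closed_field_poly_normal (char_poly A).
rewrite (monicP (char_poly_monic A)) scale1r => Es.
exists s; split => //.
  by have := size_char_poly A; rewrite Es size_prod_XsubC => -[].
by move=> a; rewrite /spectrum /= eigenvalue_root_char Es root_prod_XsubC.
Qed.

Lemma char_coef_bound n (A : 'M[Cplx R]_n) k : (0 < n)%N ->
  spectral_ball R n A -> normc (char_poly A)`_k <= 2 ^+ n.
Proof.
move=> n0 A1; have [_ Amax] := spectral_radius_max A n0.
have [s [-> sn sP]] := char_poly_roots A.
rewrite -[X in 2 ^+ X]sn; apply: coef_prod_XsubC_bound => a /sP/Amax/le_trans; apply.
exact: ltW.
Qed.

Lemma spectrum_char_poly n (A B : 'M[Cplx R]_n) :
  char_poly A = char_poly B -> spectrum A = spectrum B.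
Proof.
by move=> AB; apply/seteqP; split=> a; rewrite /spectrum /= !eigenvalue_root_char AB.
Qed.

End Jets.

(** * Isospectral curves *)

Section IsospectralCurves.
Variable R : realType.

Lemma jet_uniq N f (p q : {poly Cplx R}) :
  jet N f p -> jet N f q -> 'X^N %| p - q.
Proof.
move=> [K [d [d0 KP]]] [K' [d' [d'0 K'P]]].
apply: (@dvdXn_of_small R (p - q) N (K' + K) (Num.min d d')) => [|z _].
  by rewrite lt_min d0.
rewrite lt_min => /andP[/KP H /K'P H'].
have -> : (p - q).[z] = (f z - q.[z]) - (f z - p.[z]).
  by rewrite hornerD hornerN; ring.
by rewrite mulrDl (le_trans (ler_normcB _ _)) // lerD.
Qed.

Lemma jet_cderiv N f (p : {poly Cplx R}) : (1 < N)%N -> jet N f p ->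
  f 0 = p`_0 /\ cderiv f 0 p`_1.
Proof.
case: N => [//|[//|N]] _ [K [d [d0 KP]]].
have f0 : f 0 = p.[0].
  apply/eqP; rewrite -subr_eq0; apply/eqP/eq0_normc/eqP.
  rewrite eq_le normc_ge0 andbT.
  by have := KP 0; rewrite normc0 exprS mul0r mulr0; apply.
split; first by rewrite f0 horner_coef0.
have p1 : p^`().[0] = p`_1 by rewrite horner_coef0 coef_deriv mulr1n.
move=> e e0; have e2 : 0 < e / 2 by rewrite divr_gt0.
have [d' d'0 d'P] := is_derive_cderiv (is_derive_horner p 0) e2.
have K0 : 0 < `|K| + 1 by rewrite ltr_wpDl.
exists (Num.min (Num.min d d') (Num.min 1 (e / 2 / (`|K| + 1)))).
  by rewrite !lt_min d0 d'0 ltr01 divr_gt0.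
move=> h; rewrite !lt_min ltr_pdivlMr // => /andP[/andP[hd hd'] /andP[h1 hK]].
have h0 := normc_ge0 h.
have -> : f (0 + h) - f 0 - p`_1 * h = (f h - p.[h]) +
    (p.[0 + h] - p.[0] - p^`().[0] * h).
  by rewrite f0 p1 add0r; ring.
rewrite (le_trans (ler_normcD _ _)) // (splitr e) mulrDl lerD ?d'P //.
rewrite (le_trans (KP _ hd)) // exprS mulrCA mulrC ler_wpM2r //.
apply: le_trans (ltW hK).
have hN : normc h ^+ N <= 1 by rewrite exprn_ile1 // ltW.
rewrite exprS mulrCA ler_wpM2l //.
have [K0'|/ltW K0'] := leP 0 K.
  by rewrite (le_trans (ler_piMr K0' hN)) // (le_trans (ler_norm K)) // lerDl.
by rewrite (le_trans (mulr_le0_ge0 K0' _)) ?exprn_ge0 // ltW.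
Qed.

Lemma matrix_jet n (phi : Cplx R -> 'M[Cplx R]_n) (r M : R) N :
  0 < r -> (1 < N)%N ->
  (forall z, normc z < r -> derivable phi z 1) ->
  (forall z i j, normc z < r -> normc (phi z i j) <= M) ->
  exists P : 'M[{poly Cplx R}]_n, forall i j,
    [/\ (size (P i j) <= N)%N,
        forall l, normc (P i j)`_l <= 2 * M / (r / 2) ^+ l,
        jet N (fun z => phi z i j) (P i j),
        (P i j)`_0 = phi 0 i j & (P i j)`_1 = 'D_1 phi 0 i j].
Proof.
move=> r0 N1 dphi phiM.
have dij z i j : normc z < r -> cderiv (fun z => phi z i j) z ('D_1 phi z i j).
  move=> zr; apply: is_derive_cderiv; move: i j; apply/is_derive_mxP.
  by apply: DeriveDef => //; exact: dphi.
have r20 : 0 < r / 2 by rewrite divr_gt0.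
have r2r : r / 2 < r by lra.
have ex (ij : 'I_n * 'I_n) : exists p : {poly Cplx R},
    [/\ (size p <= N)%N, forall l, normc p`_l <= 2 * M / (r / 2) ^+ l &
        jet N (fun z => phi z ij.1 ij.2) p].
  have [||p [sp pM pjet]] :=
    @taylor_jet R (fun z => phi z ij.1 ij.2) r (r / 2) M N r20 r2r.
  - by move=> w wr; exists ('D_1 phi w ij.1 ij.2); exact: dij.
  - by move=> w wr; apply: phiM; exact: le_lt_trans wr r2r.
  (* The circle has radius r / 2, and the Taylor estimate holds for 2 |z| < r / 2. *)
  exists p; split => //; exists (4 * M / (r / 2) ^+ N), (r / 4).
  split; first by rewrite divr_gt0.
  by move=> z zr; apply: pjet; lra.
have [P PP] := choice ex.
exists (\matrix_(i, j) P (i, j)) => i j; rewrite mxE.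
have [sp pM pjet] := PP (i, j); split => //.
  by have [] := jet_cderiv N1 pjet.
have [_ H] := jet_cderiv N1 pjet.
by apply: cderiv_uniq H _; apply: dij; rewrite normc0.
Qed.

Lemma isospectral_curve n (A B : 'M[Cplx R]_n) (P : 'M[{poly Cplx R}]_n) :
  spectral_ball R n A ->
  (forall i j, (P i j)`_0 = A i j) -> (forall i j, (P i j)`_1 = B i j) ->
  (forall k, 'X^(2 * n`!) %| (char_poly P)`_k - ((char_poly A)`_k)%:P) ->
  exists psi : Cplx R -> 'M[Cplx R]_n,
    [/\ forall z, derivable psi z 1, forall z, isospectral A (psi z),
        psi 0 = A & 'D_1 psi 0 = B].
Proof.
move=> hA P0 P1 PA.
have [|Psi /mxdvdP PsiP PsiA] := isospectral_curve_of_jet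
    (char_poly_monic A) (size_char_poly A) (P := P).
  by move=> k; rewrite coef_map.
pose psi z := map_mx (horner_eval z) Psi.
have psi' (z : Cplx R) :
    is_derive z 1 psi (map_mx (horner_eval z) (map_mx (@deriv _) Psi)).
  apply/is_derive_mxP => i j; under eq_fun do rewrite mxE.
  by rewrite !mxE; exact: is_derive_horner.
have PsiE i j l : (l < 2)%N -> (Psi i j)`_l = (P i j)`_l.
  move=> l2; have /dvdXn_coef/(_ l l2) := PsiP i j.
  by rewrite !mxE coefB => /eqP; rewrite subr_eq0 => /eqP.
have psiA z : char_poly (psi z) = char_poly A.
  rewrite /psi -map_char_poly PsiA; apply/polyP => k.
  by rewrite !coef_map /= /horner_eval hornerC.
exists psi; split.
- by move=> z; have [] := psi' z.
- move=> z; have spE := spectrum_char_poly (psiA z).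
  split; last exact: spE.
  by rewrite /spectral_ball /= /spectral_radius spE; exact: hA.
- apply/matrixP => i j.
  by rewrite mxE /horner_eval horner_coef0 PsiE // P0.
have [_ ->] := psi' 0; apply/matrixP => i j.
by rewrite !mxE /horner_eval horner_coef0 coef_deriv mulr1n PsiE.
Qed.

Lemma mx_entry_le m n (A : 'M[Cplx R]_(m, n)) (M : R) i j :
  `|A| <= M%:C -> normc (A i j) <= M.
Proof.
move=> AM; apply/ler_addgt0Pr => e e0.
have : ball (0 : 'M[Cplx R]_(m, n)) (M + e)%:C A.
  rewrite mx_norm_ball /ball_ /= sub0r normrN (le_lt_trans AM) //.
  by rewrite ltcR ltrDl.
move=> [_ /(_ i j)]; rewrite mxE -ball_normE /ball_ /= sub0r normrN normE ltcR.
exact: ltW.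
Qed.

Lemma derivable_locally_bounded n (phi : Cplx R -> 'M[Cplx R]_n) :
  derivable phi 0 1 -> exists d M : R, 0 < d /\
    forall z, normc z < d -> `|phi z| <= M%:C.
Proof.
move=> /derivable1_diffP/differentiable_continuous/cvgrPdist_le/(_ 1 ltr01).
move=> /nbhs_ballP[d /= d0 dP].
have [dr dE] : exists r : R, d = r%:C.
  by apply/complex_realP; rewrite realE ltW.
have [M ME] : exists r : R, `|phi 0| = r%:C.
  by apply/complex_realP; rewrite realE normr_ge0.
exists dr, (M + 1); split; first by rewrite -ltcR -dE.
move=> z zd; rewrite rmorphD rmorph1 /= -ME -lerBlDl.
apply: le_trans (lerB_dist _ _) _.
rewrite distrC; apply: dP; rewrite -ball_normE /ball_ /= sub0r normrN normE dE ltcR.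
exact: zd.
Qed.

Lemma discE (r : R) z : disc r z <-> normc z < r.
Proof. by rewrite /disc /= normE ltcR. Qed.

Lemma finite_separation (T : finType) (v : T -> Cplx R) (v0 : Cplx R) :
  exists2 d : R, 0 < d & forall t, normc (v t - v0) < d -> v t = v0.
Proof.
suff [d d0 dP] : exists2 d : R, 0 < d &
    forall t, t \in enum T -> normc (v t - v0) < d -> v t = v0.
  by exists d => // t; apply: dP; rewrite mem_enum.
elim: (enum T) => [|t s [d d0 dP]]; first by exists 1.
have [E|vt] := eqVneq (v t) v0.
  exists d => // u; rewrite inE => /orP[/eqP-> //|]; exact: dP.
have vt0 : 0 < normc (v t - v0).
  rewrite lt_neqAle normc_ge0 andbT eq_sym; apply: contra vt => /eqP/eq0_normc.
  by move=> /eqP; rewrite subr_eq0.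
exists (Num.min d (normc (v t - v0))); first by rewrite lt_min d0.
move=> u; rewrite inE lt_min => /orP[/eqP->|us] /andP[ud uv].
  by rewrite ltxx in uv.
exact: dP.
Qed.

(** [spectrum] forgets multiplicities, but every such characteristic polynomial comes from an
    n-tuple of eigenvalues of [A]. The coefficient thus takes finitely many values, and these are
    separated. *)
Lemma isospectral_char_coef n (A : 'M[Cplx R]_n) k :
  exists2 d : R, 0 < d & forall C : 'M[Cplx R]_n, spectrum C = spectrum A ->
    normc ((char_poly C)`_k - (char_poly A)`_k) < d ->
    (char_poly C)`_k = (char_poly A)`_k.
Proof.
have [s [_ _ sP]] := char_poly_roots A.
pose v (t : n.-tuple (seq_sub s)) : Cplx R :=
  (\prod_(a <- map val t) ('X - (a : Cplx R)%:P))`_k.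
have [d d0 dP] := finite_separation v (char_poly A)`_k.
exists d; first exact: d0.
move=> C CA.
suff [t tE] : exists t, v t = (char_poly C)`_k.
  by have := dP t; rewrite tE.
have [s' [-> s'n s'P]] := char_poly_roots C.
have s's a : a \in s' -> a \in s by move/s'P; rewrite CA => /sP.
have [t tE] : exists t : seq (seq_sub s), map val t = s'.
  elim: s' s's {s'n s'P} => [|a s' IH] s's; first by exists [::].
  have [t tE] := IH (fun b bs => s's b (mem_behead (s := a :: s') bs)).
  by exists (SeqSub (s's a (mem_head _ _)) :: t); rewrite /= tE.
have st : size t == n by rewrite -s'n -tE size_map.
by exists (Tuple st); rewrite /v /= tE.
Qed.

(** Each coefficient of the characteristic polynomial is continuous with discrete values, hence
    constant near 0; so that of the jet is constant modulo X^(2 n!). *)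
Lemma isospectral_disc_to_curve n (A B : 'M[Cplx R]_n) (r : R)
    (phi : Cplx R -> 'M[Cplx R]_n) : spectral_ball R n A ->
  0 < r -> (forall z, normc z < r -> derivable phi z 1) ->
  (forall z, normc z < r -> isospectral A (phi z)) ->
  phi 0 = A -> 'D_1 phi 0 = B ->
  exists psi : Cplx R -> 'M[Cplx R]_n,
    [/\ forall z, derivable psi z 1, forall z, isospectral A (psi z),
        psi 0 = A & 'D_1 psi 0 = B].
Proof.
move=> hA r0 dphi isoA phi0 phi'.
have d0 : derivable phi 0 1 by apply: dphi; rewrite normc0.
have [d [M [d_gt0 dM]]] := derivable_locally_bounded d0.
have m0 : 0 < Num.min r d by rewrite lt_min r0.
have N1 : (1 < 2 * n`!)%N by exact: (@leq_mul 2 1 2 n`! (leqnn 2) (fact_gt0 n)).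
have [||P PP] := @matrix_jet n phi (Num.min r d) M (2 * n`!)%N m0 N1.
- by move=> z; rewrite lt_min => /andP[/dphi].
- by move=> z i j; rewrite lt_min => /andP[_ /dM]; exact: mx_entry_le.
apply: (@isospectral_curve n A B P hA).
- by move=> i j; have [_ _ _ -> _] := PP i j; rewrite phi0.
- by move=> i j; have [_ _ _ _ ->] := PP i j; rewrite phi'.
move=> k.
have [|K [d1 [d1_gt0 KP]]] := @char_coef_jet R n (2 * n`!) phi P _ k.
  by move=> i j; have [] := PP i j.
have [e e0 eP] := isospectral_char_coef A k.
have /derivableP/is_derive_cderiv/cderiv_continuous gc :=
  @char_coef_derivable R n phi 0 k d0.
have e2 : 0 < e / 2 by rewrite divr_gt0.
have [d2 d2_gt0 d2P] := gc _ e2.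
rewrite -opprB dvdpNr.
apply: (@dvdXn_of_small R _ _ K (Num.min r (Num.min d1 d2))) => [|z _].
  by rewrite !lt_min r0 d1_gt0.
rewrite !lt_min => /andP[zr /andP[zd1 zd2]].
have gE : (char_poly (phi z))`_k = (char_poly A)`_k.
  apply: eP; first exact: (proj2 (isoA z zr)).
  have := d2P z zd2; rewrite add0r phi0 => H; apply: le_lt_trans H _; lra.
rewrite hornerD hornerN hornerC -gE.
exact: KP.
Qed.

End IsospectralCurves.

(** * Cluster points of jets on growing discs *)

Section LargeDiscs.
Variable R : realType.

Lemma cvg_small_eq0 (T : Type) (G : set_system T) (GP : ProperFilter G)
    (u : T -> Cplx R) (v : Cplx R) : u @ G --> v ->
  (forall e, 0 < e -> G [set t | normc (u t) <= e]) -> v = 0.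
Proof.
move=> /cvgrPdist_le uv u_small; apply/eq0_normc/eqP.
rewrite eq_le normc_ge0 andbT; apply/ler_addgt0Pr => e e0; rewrite add0r.
have e2 : 0 < e / 2 by rewrite divr_gt0.
have /uv uve : 0 < (e / 2)%:C :> Cplx R by rewrite ltcR.
have [t /= [ut ue]] := filter_ex (filterI uve (u_small _ e2)).
move: ut; rewrite normE lecR => ut.
have -> : v = (v - u t) + u t by ring.
by rewrite (le_trans (ler_normcD _ _)) // (splitr e) lerD.
Qed.

Lemma char_poly_coef_coef0 n (P : 'M[{poly Cplx R}]_n) (A : 'M[Cplx R]_n) k :
  (forall i j, (P i j)`_0 = A i j) -> ((char_poly P)`_k)`_0 = (char_poly A)`_k.
Proof.
move=> PA; rewrite -horner_coef0 -[LHS]/(horner_eval 0 _).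
have -> : A = map_mx (horner_eval 0) P.
  by apply/matrixP => i j; rewrite mxE /horner_eval horner_coef0 PA.
by rewrite -map_char_poly coef_map.
Qed.

(** The spectral ball bounds the coefficients of the characteristic polynomial by 2^n on the whole
    disc, so Cauchy's estimate applies to them at radius r / 2; [jet_uniq] identifies their Taylor
    coefficients with those of [char_poly P]. *)
Lemma char_coef_cauchy n (phi : Cplx R -> 'M[Cplx R]_n) (r : R) N
    (P : 'M[{poly Cplx R}]_n) k l : (0 < n)%N -> 0 < r -> (l < N)%N ->
  (forall z, normc z < r -> derivable phi z 1) ->
  (forall z, normc z < r -> spectral_ball R n (phi z)) ->
  (forall i j, jet N (fun z => phi z i j) (P i j)) ->
  normc ((char_poly P)`_k)`_l <= 2 * 2 ^+ n / (r / 2) ^+ l.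
Proof.
move=> n0 r0 lN dphi phi1 phiP.
have r20 : 0 < r / 2 by rewrite divr_gt0.
have r2r : r / 2 < r by lra.
have [||t [_ tM tjet]] := @taylor_jet R (fun z => (char_poly (phi z))`_k)
    r (r / 2) (2 ^+ n) N r20 r2r.
- move=> w wr; exists ('D_1 (fun z => (char_poly (phi z))`_k) w).
  apply: is_derive_cderiv; apply: DeriveDef; last exact: erefl.
  by apply: char_coef_derivable; exact: dphi.
- by move=> w wr; apply: char_coef_bound => //; apply: phi1; exact: le_lt_trans wr r2r.
have tj : jet N (fun z => (char_poly (phi z))`_k) t.
  exists (4 * 2 ^+ n / (r / 2) ^+ N), (r / 4); split; first by rewrite divr_gt0.
  by move=> z zr; apply: tjet; lra.
have /dvdXn_coef/(_ l lN) := jet_uniq (char_coef_jet phiP k) tj.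
rewrite coefB => /eqP; rewrite subr_eq0 => /eqP ->.
exact: tM.
Qed.

(** Two radii play different roles: the fixed [delta] bounds the jets of the maps, while the growing
    [r j] forces the higher coefficients of their characteristic polynomials to 0. *)
Lemma large_discs_to_curve n (A B : 'M[Cplx R]_n) (r : nat -> R)
    (phi : nat -> Cplx R -> 'M[Cplx R]_n) (delta M : R) :
  (0 < n)%N -> spectral_ball R n A ->
  (forall j, 0 < r j) -> r @ \oo --> +oo%R ->
  (forall j z, normc z < r j -> derivable (phi j) z 1) ->
  (forall j z, normc z < r j -> spectral_ball R n (phi j z)) ->
  0 < delta -> (forall j, delta <= r j) ->
  (forall j z, normc z < delta -> `|phi j z| <= M%:C) ->
  (forall j, phi j 0 = A /\ 'D_1 (phi j) 0 = B) ->
  exists psi : Cplx R -> 'M[Cplx R]_n,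
    [/\ forall z, derivable psi z 1, forall z, isospectral A (psi z),
        psi 0 = A & 'D_1 psi 0 = B].
Proof.
move=> n0 hA r0 roo dphi phi1 delta0 delta_r phiM phiAB.
pose N := (2 * n`!)%N.
have N1 : (1 < N)%N by exact: (@leq_mul 2 1 2 n`! (leqnn 2) (fact_gt0 n)).
have /choice[P_ P_P] : forall m, exists P : 'M[{poly Cplx R}]_n, forall i j,
    [/\ (size (P i j) <= N)%N,
        forall l, normc (P i j)`_l <= 2 * M / (delta / 2) ^+ l,
        jet N (fun z => phi m z i j) (P i j),
        (P i j)`_0 = A i j & (P i j)`_1 = B i j].
  move=> m; have [phi0 phi'] := phiAB m.
  have [||P PP] := @matrix_jet R n (phi m) delta M N delta0 N1.
  - by move=> z zd; apply: dphi; exact: lt_le_trans zd (delta_r m).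
  - by move=> z i j zd; apply: mx_entry_le; exact: phiM.
  by exists P => i j; have := PP i j; rewrite phi0 phi'.
(* An ultrafilter finer than convergence to infinity makes all jet coefficients converge at once,
   without extracting subsequences. *)
have [G [GU Goo]] := ultraFilterLemma (@eventually_filter).
have GP := @ultra_proper _ _ GU.
have /choice[L LP] : forall x : 'I_n * 'I_n * nat, exists l : Cplx R,
    (fun m => (P_ m x.1.1 x.1.2)`_x.2 : Cplx R) @ G --> l.
  move=> [[i j] l] /=.
  apply: (@ultra_cvg_complex R G GU _ (2 * M / (delta / 2) ^+ l)) => m.
  by have [_ -> _ _ _] := P_P m i j.
pose P := \matrix_(i < n, j < n) \poly_(l < N) L (i, j, l).
have Pcvg i j l : (fun m => (P_ m i j)`_l : Cplx R) @ G --> ((P i j)`_l : Cplx R).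
  rewrite mxE coef_poly; case: ifPn => [_|lN]; first exact: (LP (i, j, l)).
  have -> : (fun m => (P_ m i j)`_l) = (fun=> 0).
    apply/funext => m; have [sP _ _ _ _] := P_P m i j.
    by rewrite nth_default // (leq_trans sP) // leqNgt.
  exact: cvg_cst.
have cst_lim (u : nat -> Cplx R) c l : u @ G --> l -> (forall m, u m = c) -> l = c.
  move=> ul uc; have uE : u = (fun=> c) by apply/funext.
  by apply: (cvg_unique _ ul); [exact: norm_hausdorff|rewrite uE; exact: cvg_cst].
have P0 i j : (P i j)`_0 = A i j.
  by apply: (cst_lim _ _ _ (Pcvg i j 0%N)) => m; have [_ _ _ -> _] := P_P m i j.
have P1 i j : (P i j)`_1 = B i j.
  by apply: (cst_lim _ _ _ (Pcvg i j 1%N)) => m; have [_ _ _ _ ->] := P_P m i j.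
apply: (isospectral_curve hA P0 P1) => k; apply/dvdXn_coef => -[|l] lN.
  by rewrite coefB (char_poly_coef_coef0 k P0) coefC eqxx subrr.
rewrite coefB coefC /= subr0.
apply: (cvg_small_eq0 GP (@char_coef_cvg R n G GP P_ P Pcvg k l.+1)) => e e0.
(* The entry 2 gives (r/2)^(l+1) >= r/2; the other gives 2 * 2^n <= e r/2. *)
pose T := Num.max 2 (2 * (2 * 2 ^+ n) / e).
have : G [set m | T <= r m] by apply: Goo; move/cvgryPge: roo; apply.
apply: filterS => m /=; rewrite ge_max ler_pdivrMr // => /andP[rm2 rme].
apply: (le_trans (@char_coef_cauchy n (phi m) (r m) N (P_ m) k l.+1
  n0 (r0 m) lN (dphi m) (phi1 m) _)).
  by move=> i j; have [] := P_P m i j.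
rewrite ler_pdivrMr ?exprn_gt0 ?divr_gt0 //.
have r1 : 1 <= r m / 2 by lra.
apply: (@le_trans _ _ (e * (r m / 2))); first by lra.
by rewrite ler_pM2l // exprS ler_peMr ?exprn_ege1 //; lra.
Qed.

End LargeDiscs.

Unset Implicit Arguments.

Theorem corollary2 (R : realType) (n : nat) (A B : 'M[Cplx R]_n)
    (n_gt0 : (0 < n)%N) (hA : spectral_ball R n A) (hB : tangent_cone A B) :
  [<-> (* (a) *)
       exists phi : Cplx R -> 'M[Cplx R]_n,
         [/\ holomorphic setT phi,
             forall z, spectral_ball R n (phi z),
             phi 0 = A & 'D_1 phi 0 = B];
       (* (b) *)
       exists (r : nat -> R) (phi : nat -> Cplx R -> 'M[Cplx R]_n),
         [/\ (forall j, 0 < r j) /\ r @ \oo --> +oo%R,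
             forall j, holomorphic (disc (r j)) (phi j),
             forall j z, disc (r j) z -> spectral_ball R n (phi j z),
             exists delta M : R,
               [/\ 0 < delta, forall j, delta <= r j &
                   forall j z, disc delta z -> `|phi j z| <= M%:C] &
             forall j, phi j 0 = A /\ 'D_1 (phi j) 0 = B];
       (* (c) *)
       exists (r : R) (phi : Cplx R -> 'M[Cplx R]_n),
         [/\ 0 < r, holomorphic (disc r) phi,
             forall z, disc r z -> isospectral A (phi z),
             phi 0 = A & 'D_1 phi 0 = B]].
Proof.
do !split.
- move=> [phi [dphi phi1 phi0 phi']].
  have [d [M [d0 dM]]] := derivable_locally_bounded (dphi 0 I).
  (* Starting the radii at [d], where [phi] is bounded, lets [d] serve as the common
     neighbourhood. *)
  exists (fun j => d + j%:R), (fun=> phi); split.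
  + split; first by move=> j; rewrite ltr_pwDl.
    apply/cvgryPge => x; exists (Num.truncn `|x|).+1 => // j /= xj.
    rewrite (le_trans (ler_norm x)) //.
    have /andP[_ /ltW/le_trans] := truncn_itv (normr_ge0 x); apply.
    by rewrite (@le_trans _ _ j%:R) ?ler_nat // lerDr ltW.
  + by move=> j z _; exact: dphi.
  + by move=> j z _; exact: phi1.
  + exists d, M; split => //; first by move=> j; rewrite lerDl.
    by move=> j z /discE; exact: dM.
  + by [].
- move=> [r [phi [[r0 roo] dphi phi1 [delta [M [delta0 delta_r phiM]]] phiAB]]].
  have dphi' j z : normc z < r j -> derivable (phi j) z 1.
    by move/discE; exact: dphi.
  have phi1' j z : normc z < r j -> spectral_ball R n (phi j z).
    by move/discE; exact: phi1.
  have phiM' j z : normc z < delta -> `|phi j z| <= M%:C.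
    by move/discE; exact: phiM.
  have [psi [dpsi isoA psi0 psi']] := large_discs_to_curve n_gt0 hA r0 roo
    dphi' phi1' delta0 delta_r phiM' phiAB.
  (* The curve [psi] is entire, so the radius 1 is arbitrary. *)
  exists 1, psi; split; [exact: ltr01|by move=> z _; exact: dpsi|
    by move=> z _; exact: isoA|exact: psi0|exact: psi'].
- move=> [r [phi [r0 dphi isoA phi0 phi']]].
  have dphi' z : normc z < r -> derivable phi z 1.
    by move/discE; exact: dphi.
  have isoA' z : normc z < r -> isospectral A (phi z).
    by move/discE; exact: isoA.
  have [psi [dpsi psiA psi0 psi']] :=
    isospectral_disc_to_curve hA r0 dphi' isoA' phi0 phi'.
  exists psi; split; [by move=> z _; exact: dpsi| |exact: psi0|exact: psi'].
  by move=> z; exact: (proj1 (psiA z)).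
Qed.
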